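(* Let $\varrho$ be a pseudo-metric on $\mathbb{R}^d$ with the properties listed in the context, with associated family of balls $\mathcal{B}_\varrho$. Let $W$ be a matrix weight in $\mathbf{A}_p(\mathcal{B}_\varrho)$ for some $1<p<\infty$, $1/p+1/p'=1$, and let $\{A_B\}_{B\in\mathcal{B}_\varrho}$ and $\{A_B^{\#}\}_{B\in\mathcal{B}_\varrho}$ be associated sequences of reducing operators (as defined in the context). Then there exist $\delta>0$ and constants $C_q$ such that for all $B\in\mathcal{B}_\varrho$, $$\frac1{|B|}\int_B\|W^{1/p}(t)A_B^{\#}\|^q\,dt\le C_q\quad\text{for all }0<q<p+\delta,$$ $$\frac1{|B|}\int_B\|A_BW^{-1/p}(x)\|^q\,dx\le C_q\quad\text{for all }0<q<p'+\delta.$$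
   Context: Pseudo-metric: $\varrho:\mathbb{R}^d\times\mathbb{R}^d\to[0,\infty)$ is a fixed function such that (1) $\varrho(x,x)=0$; (2) $\varrho(x,y)=\varrho(y,x)$; (3) there is a constant $c$ with $\varrho(x,z)\le c[\varrho(x,y)+\varrho(y,z)]$ for all $x,y,z$; (4) for each open neighborhood $O$ of $x\in\mathbb{R}^d$ there is $\epsilon>0$ with $B_\varrho(x,\epsilon):=\{y\in\mathbb{R}^d:\varrho(x,y)<\epsilon\}\subseteq O$; (5) the balls $B_\varrho(x,r)$ are (Lebesgue) measurable, $|B_\varrho(x,r)|$ is continuous as a function of $r>0$, and there is a constant $c'$ with $|B_\varrho(x,2r)|\le c'|B_\varrho(x,r)|$ for all $x\in\mathbb{R}^d$, $r>0$. Put $\mathcal{B}_\varrho:=\{B_\varrho(x,r):x\in\mathbb{R}^d,r>0\}$. Matrix weights: a matrix weight is a measurable function $W:\mathbb{R}^d\to\mathbb{C}^{N\times N}$ that is strictly positive definite almost everywhere; real powers are taken in the sense of the functional calculus. $|\cdot|$ is the Euclidean norm on $\mathbb{C}^N$ and $\|\cdot\|$ is a fixed matrix norm on $\mathbb{C}^{N\times N}$. Write $\fint_E f:=|E|^{-1}\int_E f$. For $1<p<\infty$, $W\in\mathbf{A}_p(\mathcal{B}_\varrho)$ means $$[W]_{\mathbf{A}_p(\mathcal{B}_\varrho)}:=\sup_{E\in\mathcal{B}_\varrho}\Big[\fint_E\Big(\fint_E\|W^{1/p}(x)W^{-1/p}(t)\|^{p'}dt\Big)^{p/p'}dx\Big]^{1/p}<\infty.$$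 Reducing operators: $\{A_B\}_{B\in\mathcal{B}_\varrho}$ and $\{A_B^{\#}\}_{B\in\mathcal{B}_\varrho}$ are families of positive definite $N\times N$ matrices such that $$\Big(\fint_B|W^{1/p}(t)x|^p\,dt\Big)^{1/p}\asymp|A_Bx|,\qquad \Big(\fint_B|W^{-1/p}(t)x|^{p'}\,dt\Big)^{1/p'}\asymp|A_B^{\#}x|,$$ with equivalence constants uniform in $B\in\mathcal{B}_\varrho$ and $x\in\mathbb{C}^N$. (Such families exist.) *)

(* Defs.v *)
From HB Require Import structures.
From mathcomp Require Import all_boot all_order all_algebra.
From mathcomp Require Import spectral complex.
From mathcomp Require Import all_classical all_reals all_analysis.

Set Implicit Arguments.
Unset Strict Implicit.
Unset Printing Implicit Defensive.

Import Order.TTheory GRing.Theory Num.Theory.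
Import numFieldNormedType.Exports.

Local Open Scope classical_set_scope.
Local Open Scope ring_scope.

(* R^d with d >= 1 is encoded as 'rV[R]_d.+1.  Lebesgue measure is the
   restriction of the outer measure generated by the volumes of half-open boxes
   to its Caratheodory measurable sets, which are exactly the Lebesgue
   measurable sets (not only the Borel sets). *)
Section lebesgue.
Context {R : realType} {d : nat}.
Implicit Types (Q : 'rV[R]_d.+1 * 'rV[R]_d.+1) (A : set 'rV[R]_d.+1).

Definition box Q : set 'rV[R]_d.+1 :=
  [set x | forall i, Q.1 0 i < x 0 i <= Q.2 0 i].

Definition box_vol Q : R := \prod_(i < d.+1) Num.max 0 (Q.2 0 i - Q.1 0 i).

Definition box_cover A : set (nat -> 'rV[R]_d.+1 * 'rV[R]_d.+1) :=
  [set Q | A `<=` \bigcup_k box (Q k)].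

Definition lebesgue_outer A : \bar R :=
  ereal_inf [set (\sum_(k <oo) (box_vol (Q k))%:E)%E | Q in box_cover A].

Lemma box_vol_ge0 Q : 0 <= box_vol Q.
Proof. by apply: prodr_ge0 => i _; rewrite le_max lexx. Qed.

Local Open Scope ereal_scope.

Let volE_ge0 Q : 0 <= (box_vol Q)%:E.
Proof. by rewrite lee_fin box_vol_ge0. Qed.

Let le_lebesgue_outer : {homo lebesgue_outer : A B / A `<=` B >-> A <= B}.
Proof.
move=> A B AB; apply/ereal_inf_le_tmp => x [Q BQ <-{x}].
by exists Q => //; exact: subset_trans AB BQ.
Qed.

Let lebesgue_outer_ge0 A : 0 <= lebesgue_outer A.
Proof.
apply: le_ereal_inf_tmp => x [Q AQ <-{x}]; exact: nneseries_ge0.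
Qed.

Let lebesgue_outer0 : lebesgue_outer set0 = 0.
Proof.
apply/eqP; rewrite eq_le lebesgue_outer_ge0 andbT.
apply: ereal_inf_lbound; exists (fun=> (0%R, 0%R)) => //.
apply: eseries0 => k _ _; rewrite /box_vol big_ord_recl /= !mxE subr0.
by rewrite maxxx mul0r.
Qed.

Let lebesgue_outer_sigma_subadditive : sigma_subadditive lebesgue_outer.
Proof.
move=> A; have [[i ioo]|] := pselect (exists i, lebesgue_outer (A i) = +oo).
  rewrite (eseries_pinfty _ _ ioo) ?leey// => n _.
  by rewrite -ltNye (lt_le_trans _ (lebesgue_outer_ge0 _)).
rewrite -forallNE => Aoo.
suff add2e (e : {posnum R}) : lebesgue_outer (\bigcup_n A n) <=
    \sum_(i <oo) lebesgue_outer (A i) + e%:num%:E.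
  by apply/lee_addgt0Pr => _/posnumP[].
rewrite (le_trans _ (epsilon_trick _ _ _))//.
pose v Q := (box_vol Q)%:E.
pose P n (Q : nat -> _) := box_cover (A n) Q /\
  \sum_(k <oo) v (Q k) <= lebesgue_outer (A n) + (e%:num / (2 ^ n.+1)%:R)%:E.
have [G PG] : {G & forall n, P n (G n)}.
  apply: (@choice _ _ P) => n.
  have Sfin : lebesgue_outer (A n) \is a fin_num.
    by rewrite ge0_fin_numE// ltey; apply/eqP/Aoo.
  have en1 : (0 < e%:num / (2 ^ n.+1)%:R)%R by [].
  have [x [Q AQ <-] Qx] := lb_ereal_inf_adherent en1 Sfin.
  by exists Q; split => //; exact/ltW.
have v_ge0 x : 0 <= (v \o uncurry G) x by exact: volE_ge0.
apply: (@le_trans _ _ (\esum_(i in setT) (v \o uncurry G) i)).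
  apply: ereal_inf_lbound => /=.
  have /card_esym/ppcard_eqP[f] := card_nat2.
  exists (uncurry G \o f).
    move=> t [i _ /(PG i).1[j _ Bijt]]; exists (f^-1%FUN (i, j)) => //=.
    by rewrite invK ?inE.
  rewrite -(esum_pred_image (v \o uncurry G) _ xpredT) ?[fun=> _]set_true//.
  by rewrite image_eq.
rewrite (_ : esum _ _ = \sum_(i <oo) \sum_(j <oo) v (G i j)); last first.
  pose J : nat -> set (nat * nat) := fun i => [set (i, j) | j in setT].
  rewrite (_ : setT = \bigcup_k J k); last first.
    by rewrite predeqE => -[a b]; split => // _; exists a => //; exists b.
  rewrite esum_bigcupT /=; last 2 first.
    - apply/trivIsetP => i j _ _ ij.
      rewrite predeqE => -[n m] /=; split => //= -[] [_] _ [<-{n} _].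
      by move=> [m' _] [] /esym/eqP; rewrite (negbTE ij).
    - by move=> /= [n m]; exact: volE_ge0.
  rewrite -(image_id [set: nat]) -fun_true esum_pred_image//; last first.
    by move=> n _; apply: esum_ge0 => x _; exact: v_ge0.
  apply: eq_eseriesr => /= j _.
  rewrite -(esum_pred_image (v \o uncurry G) (pair j) predT)/=; last 2 first.
  - by move=> n _; exact: volE_ge0.
  - by move=> ? ? _ _; exact: (@can_inj _ _ _ snd).
  by congr esum; rewrite predeqE => -[a b]; split; move=> [i _ <-]; exists i.
apply: lee_nneseries => [i _|i _]; last exact: (PG i).2.
by move=> _; apply: nneseries_ge0 => j _ _; exact: volE_ge0.
Qed.

HB.instance Definition _ := isOuterMeasure.Build R 'rV[R]_d.+1 lebesgue_outer
  lebesgue_outer0 lebesgue_outer_ge0 le_lebesgue_outer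
  lebesgue_outer_sigma_subadditive.

End lebesgue.

Notation lebesgue_type R d := (caratheodory_type (@lebesgue_outer R d)).

Definition lebesgue_mu (R : realType) (d : nat) :
  set (lebesgue_type R d) -> \bar R :=
  @lebesgue_outer R d.
Arguments lebesgue_mu : clear implicits.

HB.instance Definition _ (R : realType) (d : nat) :=
  isMeasure.Build _ _ _ (lebesgue_mu R d)
    (caratheodory_measure0 _) (@caratheodory_measure_ge0 _ _ _)
    (@caratheodory_measure_sigma_additive _ _ _).

(* The factor [fine _] makes this the usual average when 0 < |E| < +oo, which
   holds for all balls of a pseudo-metric as below. *)
Definition average (R : realType) (d : nat) (E : set 'rV[R]_d.+1)
    (f : 'rV[R]_d.+1 -> \bar R) : \bar R :=
  ((fine (lebesgue_mu R d E))^-1%:E * \int[lebesgue_mu R d]_(t in E) f t)%E.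

Definition rho_ball (R : realType) (d : nat)
    (rho : 'rV[R]_d.+1 -> 'rV[R]_d.+1 -> R) (x : 'rV[R]_d.+1) (r : R) :
  set 'rV[R]_d.+1 := [set y | rho x y < r].

Definition rho_balls (R : realType) (d : nat)
    (rho : 'rV[R]_d.+1 -> 'rV[R]_d.+1 -> R) : set (set 'rV[R]_d.+1) :=
  [set B | exists x r, 0 < r /\ B = rho_ball rho x r].

Record is_pseudo_metric (R : realType) (d : nat)
    (rho : 'rV[R]_d.+1 -> 'rV[R]_d.+1 -> R) : Prop := IsPseudoMetric {
  pm_ge0 : forall x y, 0 <= rho x y ;
  pm_refl : forall x, rho x x = 0 ;
  pm_sym : forall x y, rho x y = rho y x ;
  pm_triangle : exists c : R, forall x y z,
    rho x z <= c * (rho x y + rho y z) ;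
  pm_nbhs : forall (x : 'rV[R]_d.+1) (O : set 'rV[R]_d.+1), open O -> O x ->
    exists2 e : R, 0 < e & rho_ball rho x e `<=` O ;
  pm_measurable : forall x (r : R), 0 < r ->
    measurable (rho_ball rho x r : set (lebesgue_type R d)) ;
  pm_continuous : forall x (r : R), 0 < r ->
    {for r, continuous (fun s : R => lebesgue_mu R d (rho_ball rho x s))} ;
  pm_doubling : exists c' : R, forall x (r : R), 0 < r ->
    (lebesgue_mu R d (rho_ball rho x (2 * r)) <=
     c'%:E * lebesgue_mu R d (rho_ball rho x r))%E }.

Section complex_matrices.
Context {R : realType} {N : nat}.
Implicit Types A : 'M[R[i]]_N.

Definition cmod (z : R[i]) : R := complex.Re `|z|.

Definition cV_norm (x : 'cV[R[i]]_N) : R :=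
  Num.sqrt (\sum_(i < N) cmod (x i 0) ^+ 2).

(* Any norm on the vector space of N x N matrices; submultiplicativity is not
   required. *)
Record is_mx_norm (nrm : 'M[R[i]]_N -> R) : Prop := IsMxNorm {
  mxnorm_ge0 : forall A, 0 <= nrm A ;
  mxnorm_eq0 : forall A, nrm A = 0 -> A = 0 ;
  mxnormZ : forall (a : R[i]) A, nrm (a *: A) = cmod a * nrm A ;
  mxnormD : forall A B, nrm (A + B) <= nrm A + nrm B }.

Definition posdefmx A : Prop :=
  A \is hermsymmx /\
  forall x : 'cV[R[i]]_N, x != 0 -> 0 < ((x ^t*)%sesqui *m A *m x) 0 0.

(* Functional calculus: A^s is obtained by applying the function z |-> z^s to
   the eigenvalues in a unitary diagonalization of A.  The eigenvalues of a
   positive definite A are positive reals, so that Re does not lose anything,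
   and the result does not depend on the diagonalization. *)
Definition mxpowR A (s : R) : 'M[R[i]]_N :=
  invmx (spectralmx A)
    *m diag_mx (map_mx (fun z => (complex.Re z `^ s)%:C%C) (spectral_diag A))
    *m spectralmx A.

End complex_matrices.

Section matrix_weights.
Context {R : realType} {d N : nat}.
Implicit Types (V W : 'rV[R]_d.+1 -> 'M[R[i]]_N).

Record is_matrix_weight W : Prop := IsMatrixWeight {
  weight_measurable : forall i j,
    measurable_fun setT (fun t : lebesgue_type R d => complex.Re (W t i j)) /\
    measurable_fun setT (fun t : lebesgue_type R d => complex.Im (W t i j)) ;
  weight_posdef : {ae lebesgue_mu R d, forall t, posdefmx (W t)} }.

Definition Ap_const (nrm : 'M[R[i]]_N -> R) (p p' : R)
    (F : set (set 'rV[R]_d.+1)) W : \bar R :=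
  ereal_sup [set
    (average E (fun x =>
       (average E (fun t =>
          (nrm (mxpowR (W x) p^-1 *m mxpowR (W t) (- p^-1)) `^ p')%:E))
       `^ (p / p')) `^ p^-1)%E
  | E in F].

Definition in_Ap (nrm : 'M[R[i]]_N -> R) (p p' : R)
    (F : set (set 'rV[R]_d.+1)) W : Prop :=
  is_matrix_weight W /\ (Ap_const nrm p p' F W < +oo)%E.

(* With V = W^(1/p) and q = p this defines the A_B, with V = W^(-1/p) and
   q = p' the A_B^#. *)
Definition reducing_operators (F : set (set 'rV[R]_d.+1)) V (q : R)
    (A : set 'rV[R]_d.+1 -> 'M[R[i]]_N) : Prop :=
  (forall B, F B -> posdefmx (A B)) /\
  exists c1 c2 : R, [/\ 0 < c1, 0 < c2 & forall B, F B ->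
    forall x : 'cV[R[i]]_N,
      ((c1 * cV_norm (A B *m x))%:E <=
         (average B (fun t => (cV_norm (V t *m x) `^ q)%:E)) `^ q^-1 <=
       (c2 * cV_norm (A B *m x))%:E)%E].

End matrix_weights.

(* Main.v *)
From HB Require Import structures.
Require Import Defs.
From mathcomp Require Import all_boot all_order all_algebra.
From mathcomp Require Import finmap spectral complex.
From mathcomp Require Import all_classical all_reals all_analysis.
From mathcomp Require Import measurable_realfun ring lra.

Set Implicit Arguments.
Unset Strict Implicit.
Unset Printing Implicit Defensive.

Import Order.TTheory GRing.Theory Num.Theory.
Import numFieldNormedType.Exports.

Local Open Scope classical_set_scope.
Local Open Scope ring_scope.

(** Write V for W^(1/p) and V' for W^(-1/p).  The theorem says that the entries
of V A#_B and of A_B V' are integrable over B to an exponent slightly larger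
than p and p' respectively, with averages bounded uniformly in B.  The two
claims are exchanged by (V, p, A) <-> (V', p', A#), so only the first one needs
an argument.

At the exponent p itself the claim is the A_p condition.  Applying the defining
property of A#_B to the vectors V(s) e_j turns the A_p integral into an average
of |A#_B V(s) e_j|^p, and the defining property of A_B then bounds the entries
of A_B A#_B uniformly in B ([Ap_bounds_reducing]).

The gain over p is a reverse Hoelder inequality for the scalar weights
w_y = |V y|^p, with constants that do not depend on the vector y.  Since
|A_B y| <= C |A_B V'(t)| |V(t) y| and the average over B of |A_B V'|^p' is
bounded, Markov's inequality shows that w_y is comparable to its mean, or
larger, outside a set that fills only a small proportion of B
([matrix_weight_Ainfty]).  This quantitative A_infinity condition also makes the
measure w_y dt doubling.

For a scalar A_infinity weight w the reverse Hoelder inequality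
([reverse_holder]) comes from a weak-type estimate ([weak_type_estimate]): for
all lam above a multiple of the mean of w over a ball B, the integral of w over
B /\ {w > C1 lam} is at most C2 lam |2cB /\ {w > e lam}|, where c is the
constant of the quasi-triangle inequality.  Indeed almost every point of the first set is the centre of a ball
on which the mean of w exceeds lam while the mean over a dilate does not; a
disjoint Vitali subfamily whose dilates still cover ([vitali_bound]) gives the
estimate, because w > e lam on at least half of each selected ball.  That almost
every point has such a ball uses Lebesgue's differentiation theorem only up to a
multiplicative constant, and this follows from the same covering and outer
regularity ([small_means_negligible]).

The enlargement from B to 2cB cannot be absorbed by the usual iteration over
slightly larger concentric balls: when c > 1, a small ball centred in B need not
lie in any of them.  It is absorbed by treating all balls at once: the
inequality for w truncated at 2^n times its mean, assumed for every ball, is used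
on 2cB to obtain it on B at the level 2^(n+1), and for a small gain in the
exponent the constant reproduces itself ([truncated_reverse_holder]).

Measurability of V and V' is obtained from the class of functions f for which
f(W) is measurable: it is closed under algebraic operations and pointwise limits
on the positive half-line, and the logarithm is a limit of an iteration built
from the exponential ([measurable_mxpowR]).  Finally, Lebesgue measure enters
only through its outer regularity and the finiteness of small balls; if a single
ball is null then all of them are, and every average vanishes. *)

(** * Quasi-metric balls and Vitali coverings *)

Lemma exists_pow2_ge {R : realType} (z : R) : exists n, z <= 2 ^+ n.
Proof.
exists (Num.truncn `|z|).+1; apply: (le_trans (ler_norm _)).
apply: (le_trans (ltW (truncnS_gt _))).
by rewrite -natrX ler_nat ltnW// ltn_expl.
Qed.

Lemma iterate_doubling {R : realType} (f : R -> \bar R) (D : R) n r : 0 <= D ->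
  (forall s, 0 < s -> (f (2 * s)%R <= D%:E * f s)%E) -> 0 < r ->
  (f (2 ^+ n * r)%R <= (D ^+ n)%:E * f r)%E.
Proof.
move=> D0 dbl r0; elim: n => [|n IH]; first by rewrite !expr0 mul1r mul1e.
rewrite exprS -mulrA; apply: le_trans (dbl _ _) _.
  by rewrite mulr_gt0// exprn_gt0.
by rewrite exprS EFinM -muleA; apply: lee_wpmul2l.
Qed.

Section homogeneous_space.
Context {d : measure_display} {T : measurableType d} {R : realType}.
Variable mu : {measure set T -> \bar R}.
Variable rho : T -> T -> R.

Definition qball (x : T) (r : R) : set T := [set y | rho x y < r].

(** A space of homogeneous type.  The last field is outer regularity, phrased
without a topology: [U] plays the role of an open set, of which only the
measurable subsets are measured. *)
Record is_homogeneous (c D : R) : Prop := IsHomogeneous {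
  hom_c : 1 <= c ;
  hom_D : 1 <= D ;
  hom_ge0 : forall x y, 0 <= rho x y ;
  hom_refl : forall x, rho x x = 0 ;
  hom_sym : forall x y, rho x y = rho y x ;
  hom_triangle : forall x y z, rho x z <= c * (rho x y + rho y z) ;
  hom_measurable : forall x (r : R), 0 < r -> measurable (qball x r) ;
  hom_fin : forall x (r : R), 0 < r -> (mu (qball x r) < +oo)%E ;
  hom_pos : forall x (r : R), 0 < r -> (0 < mu (qball x r))%E ;
  hom_doubling : forall x (r : R), 0 < r ->
    (mu (qball x (2 * r)) <= D%:E * mu (qball x r))%E ;
  hom_regular : forall (H : set T) (e : R), measurable H -> (mu H < +oo)%E ->
    0 < e -> exists U : set T, [/\ H `<=` U,
      forall x, U x -> exists2 r : R, 0 < r & qball x r `<=` U &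
      forall V, measurable V -> V `<=` U -> (mu V <= mu H + e%:E)%E] }.

Context {c D : R} (hom : is_homogeneous c D).

Let c0 : 0 < c. Proof. exact: lt_le_trans (hom_c hom). Qed.

Lemma qball_center x (r : R) : 0 < r -> qball x r x.
Proof. by move=> r0; rewrite /qball /= (hom_refl hom). Qed.

Lemma le_qball x r s : r <= s -> qball x r `<=` qball x s.
Proof. by move=> rs y /= /lt_le_trans; apply. Qed.

Lemma qball_sub x y r s : rho x y <= s -> qball y r `<=` qball x (c * (s + r)).
Proof.
move=> xy z; rewrite /qball /= => yz; apply: le_lt_trans (hom_triangle hom x y z) _.
by rewrite ltr_pM2l//; lra.
Qed.

Lemma qball_measureE x (r : R) : 0 < r -> mu (qball x r) = (fine (mu (qball x r)))%:E.
Proof.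
by move=> r0; rewrite fineK// ge0_fin_numE//; exact: (hom_fin hom).
Qed.

Lemma qball_fine_gt0 x (r : R) : 0 < r -> 0 < fine (mu (qball x r)).
Proof. by move=> r0; rewrite -lte_fin -qball_measureE//; exact: (hom_pos hom). Qed.

Lemma qball_dilation (K : R) : exists2 DK : R, 1 <= DK & forall x (r : R), 0 < r ->
  (mu (qball x (K * r)) <= DK%:E * mu (qball x r))%E.
Proof.
have [n Kn] := exists_pow2_ge K.
exists (D ^+ n); first exact: exprn_ege1 (hom_D hom).
move=> x r r0; have D0 : 0 <= D by apply: le_trans (hom_D hom).
apply: le_trans (iterate_doubling n D0 (hom_doubling hom x) r0); have [Kr|Kr] := ltP 0 (K * r).
  apply: le_measure; rewrite ?inE; [| |].
  - exact: (hom_measurable hom).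
  - by apply: (hom_measurable hom); rewrite mulr_gt0// exprn_gt0.
  - by apply: le_qball; rewrite ler_pM2r.
rewrite (_ : qball x (K * r) = set0) ?measure0//.
apply/seteqP; split => // y /= h; have := le_lt_trans (hom_ge0 hom x y) h.
by rewrite ltNge Kr.
Qed.

(** Maximality is taken among the disjoint subfamilies [F] with the extra
property that a ball meeting a member of [F] meets one of at least half its
radius.  If some ball missed a maximal [F], one of nearly largest radius among
those missing [F] could be added to it. *)
Lemma vitali_selection (E : set T) (r : T -> R) (rmax : R) :
  (forall x, E x -> 0 < r x <= rmax) ->
  exists F : set T, [/\ F `<=` E, trivIset F (fun x => qball x (r x)) &
    E `<=` \bigcup_(y in F) qball y (3 * c * r y)].
Proof.
move=> Er; pose B x := qball x (r x).
pose P (F : set T) := [/\ F `<=` E, trivIset F B & forall x, E x ->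
  (exists2 y, F y & B x `&` B y !=set0) ->
  exists y, [/\ F y, B x `&` B y !=set0 & r x <= 2 * r y]].
have [|F [[FE tF FP] Fmax]] := @Zorn_bigcup T P.
  move=> C CP Ctot; split.
  - by apply: bigcup_sub => X /CP[].
  - move=> i j [X CX Xi] [Y CY Yj]; have [XY|YX] := Ctot _ _ CX CY.
      by have [_ + _] := CP _ CY; apply => //; exact: XY.
    by have [_ + _] := CP _ CX; apply => //; exact: YX.
  - move=> x Ex [y [X CX Xy] xy]; have [_ _ /(_ x Ex)] := CP _ CX.
    by case; [exists y|move=> z [Xz xz rz]; exists z; split => //; exists X].
have meets x : E x -> exists2 y, F y & B x `&` B y !=set0.
  move=> Ex; apply: contrapT => nx.
  pose S := [set z | E z /\ forall y, F y -> ~ (B z `&` B y !=set0)].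
  have Sx : S x by split => // y Fy xy; apply: nx; exists y.
  have hsS : has_sup (r @` S).
    split; first by exists (r x), x.
    by exists rmax => _ [z [Ez _] <-]; case/andP: (Er _ Ez).
  have s0 : 0 < sup (r @` S).
    have /andP[rx0 _] := Er _ Ex; apply: lt_le_trans rx0 _.
    by apply: ub_le_sup; [case: hsS|exists x].
  have s20 : 0 < sup (r @` S) / 2 by lra.
  have [_ [z [Ez nz] <-] rz] := sup_adherent s20 hsS.
  have /andP[rz0 _] := Er _ Ez.
  have Bz : B z z by exact: qball_center.
  apply: (Fmax (F `|` [set z])).
    split; last by move=> /(_ z (or_intror erefl)) Fz; apply: (nz z Fz); exists z.
    by move=> ? ?; left.
  split.
  - by move=> y [/FE//|->].
  - move=> i j [Fi|->] [Fj|->] //; first exact: tF.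
      by move=> [y [iy zy]]; exfalso; apply: (nz i) => //; exists y.
    by move=> [y [zy jy]]; exfalso; apply: (nz j) => //; exists y.
  - move=> y Ey yF.
    have [[w Fw yw]|nyF] := pselect (exists2 w, F w & B y `&` B w !=set0).
      have [v [Fv yv rv]] := FP y Ey (ex_intro2 _ _ w Fw yw).
      by exists v; split => //; left.
    case: yF => w [Fw yw|->{w} yz]; first by exfalso; apply: nyF; exists w.
    exists z; split => //; first by right.
    have : r y <= sup (r @` S).
      apply: ub_le_sup; first by case: hsS.
      by exists y => //; split => // w Fw yw; apply: nyF; exists w.
    by move: rz; lra.
exists F; split => // x Ex.
have [y [Fy [z [xz yz]] rxy]] := FP x Ex (meets x Ex); exists y => //=.
have := hom_triangle hom y z x; rewrite /B /qball /= in xz yz *.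
rewrite (hom_sym hom z x) => /le_lt_trans; apply.
by rewrite -mulrA mulrCA ltr_pM2l//; lra.
Qed.

(** At most [n * mu G] of the sets have measure at least [1 / n]. *)
Lemma countable_disjoint (I : choiceType) (F : set I) (B : I -> set T) (G : set T) :
  measurable G -> (mu G < +oo)%E -> trivIset F B ->
  (forall i, F i -> [/\ measurable (B i), B i `<=` G & (0 < mu (B i))%E]) ->
  countable F.
Proof.
move=> mG Goo tF FB.
pose Fn (n : nat) := [set i | F i /\ (n.+1%:R^-1%:E <= mu (B i))%E].
have -> : F = \bigcup_n Fn n.
  apply/seteqP; split => [i Fi|i [n _ []]//].
  have [mB BG B0] := FB i Fi.
  have Boo : (mu (B i) < +oo)%E by apply: le_lt_trans Goo; apply: le_measure; rewrite ?inE.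
  have Bfin : mu (B i) = (fine (mu (B i)))%:E by rewrite fineK// ge0_fin_numE.
  have b0 : 0 < fine (mu (B i)) by rewrite -lte_fin -Bfin.
  exists (Num.truncn (fine (mu (B i)))^-1) => //; split => //.
  rewrite Bfin lee_fin invf_ple ?posrE//; exact/ltW/truncnS_gt.
apply: bigcup_countable => // n _; apply: finite_set_countable.
apply: contrapT => infFn.
pose k := (Num.truncn (n.+1%:R * fine (mu G))).+1.
have [X XFn kX] := infinite_set_fset k infFn.
have XF : [set` X] `<=` F by move=> i /XFn[].
have : (mu (\bigcup_(i in [set` X]) B i) <= mu G)%E.
  apply: le_measure; rewrite ?inE//.
    apply: fin_bigcup_measurable; first exact: finite_fset.
    by move=> i /XF /FB[].
  by apply: bigcup_sub => i /XF /FB[].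
rewrite measure_fin_bigcup//; first last.
- by move=> i /XF /FB[].
- exact: sub_trivIset tF.
apply/negP; rewrite -ltNge.
have -> : mu G = (fine (mu G))%:E by rewrite fineK// ge0_fin_numE.
rewrite fsbig_finite/=; last exact: finite_fset.
rewrite set_fsetK.
apply: (@lt_le_trans _ _ (\sum_(i <- X) n.+1%:R^-1%:E)%E); last first.
  rewrite big_seq [leRHS]big_seq; apply: lee_sum => i iX.
  by have [] := XFn i iX.
rewrite sumEFin big_const_seq count_predT iter_addr_0.
rewrite lte_fin -[ltRHS]mulr_natl ltr_pdivlMr// mulrC.
apply: (lt_le_trans (truncnS_gt _)).
by rewrite ler_nat.
Qed.

End homogeneous_space.

Section covering_bound.
Context {d : measure_display} {T : measurableType d} {R : realType}.
Variable mu : {measure set T -> \bar R}.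
Variable rho : T -> T -> R.

Lemma ge0_integral_bigcup_le (f : T -> \bar R) (A : nat -> set T) :
  measurable_fun setT f -> (forall x, (0 <= f x)%E) ->
  (forall k, measurable (A k)) ->
  (\int[mu]_(x in \bigcup_k A k) f x <= \sum_(k <oo) \int[mu]_(x in A k) f x)%E.
Proof.
move=> mf f0 mA; rewrite seqDU_bigcup_eq ge0_integral_bigcup//=.
- apply: lee_nneseries => k _; first by move=> _; exact: integral_ge0.
  apply: ge0_subset_integral => //; first exact: seqDU_measurable.
    exact: measurable_funTS.
  exact: subset_seqDU.
- by move=> k; exact: seqDU_measurable.
- exact: measurable_funTS.
Qed.

Context {c D : R} (hom : is_homogeneous mu rho c D).

(** Vitali's lemma in the form in which it is used: an estimate relating the
integral of [w] over the dilated balls to the measure of the balls passes to a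
cover [A] of [E] on one side and to a disjoint union [V] of balls on the other.
The sets [A] and [V] depend neither on [w] nor on [L]. *)
Lemma vitali_bound (E G : set T) (r : T -> R) (rmax : R) :
  measurable G -> (mu G < +oo)%E ->
  (forall x, E x -> 0 < r x <= rmax) ->
  (forall x, E x -> qball rho x (r x) `<=` G) ->
  exists A V : set T, [/\ [/\ measurable A, measurable V, E `<=` A &
      V `<=` \bigcup_(x in E) qball rho x (r x)] &
    forall (w : T -> \bar R) (L : set T) (a : R), measurable_fun setT w ->
      (forall x, (0 <= w x)%E) -> measurable L ->
      (forall x, E x -> (\int[mu]_(y in qball rho x (3 * c * r x)) w y <=
         a%:E * mu (qball rho x (r x) `&` L))%E) ->
      (\int[mu]_(y in A) w y <= a%:E * mu (V `&` L))%E].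
Proof.
move=> mG Goo Er EG.
have [F [FE tF EF]] := vitali_selection hom Er.
pose B x := qball rho x (r x); pose BK x := qball rho x (3 * c * r x).
have r0 x : E x -> 0 < r x by move=> /Er/andP[].
have c0 : 0 < c by exact: lt_le_trans (hom_c hom).
have mB x : E x -> measurable (B x) by move=> /r0 ?; exact: (hom_measurable hom).
have mBK x : E x -> measurable (BK x).
  by move=> /r0 ?; apply: (hom_measurable hom); rewrite !mulr_gt0.
have cF : countable F.
  apply: (@countable_disjoint _ T R mu _ F B G) => // i /FE Ei; split; first exact: mB.
    exact: EG.
  by apply: (hom_pos hom); exact: r0.
have /countable_injP[f finj] := cF.
(* each class of the enumeration f of F holds at most one ball *)
pose Fk k := [set y | F y /\ f y = k].
have FkP k : Fk k = set0 \/ exists2 y, F y & Fk k = [set y].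
  have [->|/set0P[y [Fy fy]]] := eqVneq (Fk k) set0; first by left.
  right; exists y => //; apply/seteqP; split => [z [Fz fz]|_ ->//].
  by apply: finj; rewrite ?inE// fz.
have bigF (X : T -> set T) : \bigcup_(y in F) X y = \bigcup_k \bigcup_(y in Fk k) X y.
  apply/seteqP; split => [x [y Fy Xx]|x [k _ [y [Fy _] Xx]]]; last by exists y.
  by exists (f y) => //; exists y.
have mFk k (X : T -> set T) : (forall x, F x -> measurable (X x)) ->
    measurable (\bigcup_(y in Fk k) X y).
  move=> mX; have [->|[y Fy ->]] := FkP k; first by rewrite bigcup_set0.
  by rewrite bigcup_set1; exact: mX.
exists (\bigcup_(y in F) BK y), (\bigcup_(y in F) B y); split; first split => //.
- by rewrite bigF; apply: bigcup_measurable => k _; apply: mFk => x /FE; exact: mBK.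
- by rewrite bigF; apply: bigcup_measurable => k _; apply: mFk => x /FE; exact: mB.
- by move=> x [y Fy Bx]; exists y => //; exact: FE.
move=> w L a mw w0 mL wa.
rewrite bigF; apply: le_trans (ge0_integral_bigcup_le mw w0 _) _.
  by move=> k; apply: mFk => x /FE; exact: mBK.
rewrite bigF setI_bigcupl measure_semi_bigcup//; first last.
- apply: bigcup_measurable => i _; apply: measurableI => //; apply: mFk => x /FE; exact: mB.
- apply/trivIsetP => i j _ _ ij; apply/seteqP; split => // x.
  move=> [[[y [Fy fy] Bx] _] [[z [Fz fz] Bz] _]].
  suff yz : y = z by move: ij; rewrite -fy -fz yz eqxx.
  by apply: tF => //; exists x.
- by move=> i; apply: measurableI => //; apply: mFk => x /FE; exact: mB.
rewrite -nneseriesZl//; apply: lee_nneseries => k.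
  by move=> _ _; exact: integral_ge0.
move=> _; have [->|[y Fy ->]] := FkP k.
  by rewrite !bigcup_set0 set0I measure0 mule0 integral_set0.
by rewrite !bigcup_set1; apply: wa; exact: FE.
Qed.

End covering_bound.

(** * Lebesgue differentiation up to a constant *)

Section integral_bounds.
Context {d : measure_display} {T : measurableType d} {R : realType}.
Variable mu : {measure set T -> \bar R}.
Variable (w : T -> R).
Hypothesis mw : measurable_fun setT w.
Hypothesis w0 : forall x, 0 <= w x.

Lemma measurable_EFin_setT : measurable_fun setT (EFin \o w).
Proof. exact/measurable_EFinP. Qed.

Lemma measurable_gt (a : R) : measurable [set x | a < w x].
Proof.
rewrite (_ : [set x | a < w x] = setT `&` w @^-1` `]a, +oo[).
  exact: mw.
by apply/seteqP; split => x /=; rewrite in_itv/= andbT//; case.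
Qed.

Lemma measurable_lt (a : R) : measurable [set x | w x < a].
Proof.
rewrite (_ : [set x | w x < a] = setT `&` w @^-1` `]-oo, a[).
  exact: mw.
by apply/seteqP; split => x /=; rewrite in_itv/=//; case.
Qed.

Lemma measurable_ge (a : R) : measurable [set x | a <= w x].
Proof.
rewrite (_ : [set _ | _] = ~` [set x | w x < a]).
  by apply: measurableC; exact: measurable_lt.
by apply/seteqP; split => y /=; rewrite leNgt => /negP.
Qed.

Lemma large_part (X : set T) (a theta : R) : measurable X -> (mu X < +oo)%E ->
  (mu (X `&` [set y | (w y < a)%R]) <= theta%:E * mu X)%E ->
  ((1 - theta)%:E * mu X <= mu (X `&` [set y | (a <= w y)%R]))%E.
Proof.
move=> mX Xoo small.
have XE : mu X = (mu (X `&` [set y | (w y < a)%R]) + mu (X `&` [set y | (a <= w y)%R]))%E.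
  rewrite -measureU.
  - rewrite -setIUr [X in _ `&` X](_ : _ = setT) ?setIT//.
    by apply/seteqP; split => // y _ /=; have [] := ltP (w y) a; [left|right].
  - by apply: measurableI => //; exact: measurable_lt.
  - by apply: measurableI => //; exact: measurable_ge.
  - by apply/seteqP; split => // y [[_ /= h1] [_ /=]]; rewrite leNgt h1.
have Xfin : mu X \is a fin_num by rewrite ge0_fin_numE.
rewrite EFinB muleBl// mul1e leeBlDl ?fin_numM//.
by rewrite {1}XE; apply: leeD2r.
Qed.

Lemma cst_le_integral (X : set T) (a : R) : measurable X -> 0 <= a ->
  (forall x, X x -> a <= w x) ->
  (a%:E * mu X <= \int[mu]_(x in X) (w x)%:E)%E.
Proof.
move=> mX a0 aw; rewrite -integral_cst//; apply: ge0_le_integral => //.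
apply: measurable_funTS; exact: measurable_EFin_setT.
Qed.

Lemma integral_le_subset (X Y : set T) : measurable X -> measurable Y -> X `<=` Y ->
  (\int[mu]_(x in X) (w x)%:E <= \int[mu]_(x in Y) (w x)%:E)%E.
Proof.
move=> mX mY XY; apply: ge0_subset_integral => //.
  by apply: measurable_funTS; exact: measurable_EFin_setT.
by move=> x _; rewrite lee_fin.
Qed.

Lemma integral_le_subset_negligible (X Y N : set T) :
  measurable X -> measurable Y -> X `<=` Y `|` N -> mu.-negligible N ->
  (\int[mu]_(x in X) (w x)%:E <= \int[mu]_(x in Y) (w x)%:E)%E.
Proof.
move=> mX mY XYN [N' [mN' N'0 NN']].
have mwX Z : measurable_fun Z (EFin \o w).
  by apply: measurable_funTS; exact: measurable_EFin_setT.
apply: (@le_trans _ _ (\int[mu]_(x in Y `|` (N' `\` Y)) (w x)%:E)%E).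
  apply: integral_le_subset => //; first by apply: measurableU => //; exact: measurableD.
  move=> x /XYN[Yx|/NN' Nx]; first by left.
  by have [Yx|nYx] := pselect (Y x); [left|right].
rewrite ge0_integral_setU//=; first last.
- by rewrite disj_set2E; apply/eqP; rewrite setDE setICA setICr setI0.
- by move=> x _; rewrite lee_fin.
- exact: measurableD.
rewrite [X in (_ + X)%E](_ : _ = 0%E) ?adde0// null_set_integral//.
- exact: measurableD.
- by apply: subset_measure0 N'0 => //; exact: measurableD.
Qed.

End integral_bounds.

Section differentiation.
Context {d : measure_display} {T : measurableType d} {R : realType}.
Variable mu : {measure set T -> \bar R}.
Variable rho : T -> T -> R.
Context {c D : R} (hom : is_homogeneous mu rho c D).

(** The number [m] stands for the infimum of the measures of the measurable
supersets of [E], so that [E], which need not be measurable, is negligible as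
soon as this infimum vanishes. *)
Lemma negligible_inf (E H0 : set T) : measurable H0 -> E `<=` H0 ->
  (mu H0 < +oo)%E ->
  (forall m : R, (forall H, measurable H -> E `<=` H -> (m%:E <= mu H)%E) ->
     (forall e : R, 0 < e -> exists H, [/\ measurable H, H `<=` H0, E `<=` H &
        (mu H <= (m + e)%:E)%E]) -> m <= 0) ->
  mu.-negligible E.
Proof.
move=> mH0 EH0 H0oo hm.
pose S := [set mu H | H in [set H | measurable H /\ E `<=` H]].
pose m := fine (ereal_inf S).
have S0 : (0 <= ereal_inf S)%E.
  by apply: le_ereal_inf_tmp => _ [H _ <-].
have Sfin : ereal_inf S = m%:E.
  rewrite fineK// ge0_fin_numE//; apply: le_lt_trans H0oo.
  by apply: ereal_inf_lbound; exists H0.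
have lbS H : measurable H -> E `<=` H -> (m%:E <= mu H)%E.
  by move=> mH EH; rewrite -Sfin; apply: ereal_inf_lbound; exists H.
have appr e : 0 < e -> exists H, [/\ measurable H, H `<=` H0, E `<=` H &
        (mu H <= (m + e)%:E)%E].
  move=> e0; have Sf : ereal_inf S \is a fin_num by rewrite Sfin.
  have [_ [H [mH EH] <-] Hlt] := lb_ereal_inf_adherent e0 Sf.
  exists (H `&` H0); split => //; first exact: measurableI.
    by move=> x Ex; split; [exact: EH|exact: EH0].
  rewrite EFinD -Sfin; apply: le_trans (ltW Hlt).
  by apply: le_measure; rewrite ?inE//; exact: measurableI.
have m0 := hm m lbS appr.
have /choice[H HP] : forall n : nat, exists H, [/\ measurable H, H `<=` H0, E `<=` H &
    (mu H <= (n.+1%:R^-1 : R)%:E)%E].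
  move=> n; have [|H [mH H0H EH Hm]] := appr n.+1%:R^-1; first by rewrite invr_gt0.
  by exists H; split => //; apply: le_trans Hm _; rewrite lee_fin -[leRHS]add0r lerD2r.
exists (\bigcap_n H n); split.
- by apply: bigcap_measurable => // n _; have [] := HP n.
- apply/eqP; rewrite eq_le measure_ge0 andbT; apply/lee_addgt0Pr => e e0.
  rewrite add0e.
  have [] := HP (Num.truncn e^-1) => mH _ _ He.
  apply: (@le_trans _ _ (mu (H (Num.truncn e^-1)))).
    apply: le_measure; rewrite ?inE//; last exact: bigcap_inf.
    by apply: bigcap_measurable => // n _; have [] := HP n.
  apply: le_trans He _; rewrite lee_fin invf_ple ?posrE//; exact/ltW/truncnS_gt.
- by move=> x Ex n _; have [_ _ /(_ x Ex)] := HP n.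
Qed.

(** Lebesgue's differentiation theorem with a lossy constant.  Cover [E] by small
balls inside a set [U] of measure close to that of [E].  The Vitali bound gives
a cover [A] of [E] over which [w] integrates to at most [DK lam mu U], while
[w > 2 DK lam] on [E] makes the integral at least [2 DK lam mu E].  No
approximation by continuous functions is needed. *)
Lemma small_means_negligible (w : T -> R) (E : set T) (DK lam : R) x0 (r0 r1 : R) :
  measurable_fun setT w -> (forall x, 0 <= w x) ->
  1 <= DK -> (forall x r, 0 < r ->
    (mu (qball rho x (3 * c * r)) <= DK%:E * mu (qball rho x r))%E) ->
  0 < lam -> 0 < r0 -> 0 < r1 -> E `<=` qball rho x0 r0 ->
  (forall x, E x -> 2 * DK * lam < w x) ->
  (forall x r, E x -> 0 < r -> r <= r1 ->
    (\int[mu]_(y in qball rho x r) (w y)%:E <= lam%:E * mu (qball rho x r))%E) ->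
  mu.-negligible E.
Proof.
move=> mw w0 DK1 DKP lam0 r00 r10 EB Ew Elam.
have c0 : 0 < c by exact: lt_le_trans (hom_c hom).
have DK0 : 0 < DK by exact: lt_le_trans DK1.
(* only supersets on which w is large are relevant for the lower bound *)
pose H0 := qball rho x0 r0 `&` [set x | 2 * DK * lam < w x].
have mB := hom_measurable hom x0 r00.
have mH0 : measurable H0 by apply: measurableI => //; exact: measurable_gt.
apply: (@negligible_inf E H0) => //.
- by move=> x Ex; split; [exact: EB|exact: Ew].
- apply: le_lt_trans (hom_fin hom x0 r00).
  by apply: le_measure; rewrite ?inE// => x [].
move=> m mlb mappr; apply/ler_addgt0Pr => e e0; rewrite add0r.
have e20 : 0 < e / 2 by lra.
have [H [mH HH0 EH Hm]] := mappr (e / 2) e20.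
have Hoo : (mu H < +oo)%E by apply: le_lt_trans Hm _; rewrite ltry.
have [U [HU Uball Ureg]] := hom_regular hom mH Hoo e20.
have /choice[r rP] : forall x, exists r : R, E x -> [/\ 0 < r, r <= r0,
    3 * c * r <= r1 & qball rho x r `<=` U].
  move=> x; have [Ex|nEx] := pselect (E x); last by exists 0.
  have [s s0 sU] := Uball x (HU x (EH x Ex)).
  exists (Num.min s (Num.min r0 (r1 / (3 * c)))) => _; split.
  - by rewrite !lt_min s0 r00 divr_gt0// mulr_gt0.
  - by rewrite !ge_min lexx orbT.
  - by rewrite mulrC -ler_pdivlMr ?mulr_gt0// !ge_min lexx !orbT.
  - by apply: subset_trans sU; apply: le_qball; rewrite ge_min lexx.
have mG : measurable (qball rho x0 (c * (r0 + r0))).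
  by apply: (hom_measurable hom); rewrite mulr_gt0// addr_gt0.
have Goo : (mu (qball rho x0 (c * (r0 + r0))) < +oo)%E.
  by apply: (hom_fin hom); rewrite mulr_gt0// addr_gt0.
have [| |A [V [[mA mV EA VE] AV]]] := @vitali_bound _ T R mu rho c D hom E _ r r0 mG Goo.
- by move=> x Ex; have [-> ->] := rP x Ex.
- move=> x Ex; have [_ rr0 _ _] := rP x Ex.
  apply: subset_trans (qball_sub hom (ltW (EB x Ex)) (r := r0)).
  exact: le_qball.
have VU : V `<=` U.
  by move=> y /VE[x Ex]; have [_ _ _] := rP x Ex; apply.
have := AV (EFin \o w) setT (DK * lam) (measurable_EFin_setT mw).
have w0' x : (0 <= (EFin \o w) x)%E by rewrite lee_fin.
move=> /(_ w0' measurableT) {AV}AV.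
have {AV} : (\int[mu]_(y in A) (w y)%:E <= (DK * lam)%:E * mu (V `&` setT))%E.
  apply: AV => x Ex; have [rx0 _ Kr _] := rP x Ex; rewrite setIT.
  have Kr0 : 0 < 3 * c * r x by rewrite !mulr_gt0.
  apply: le_trans (Elam _ _ Ex Kr0 Kr) _.
  by rewrite [DK * lam]mulrC EFinM -muleA; apply: lee_wpmul2l; [rewrite lee_fin ltW|exact: DKP].
rewrite setIT => AV.
have mAH : measurable (A `&` H) by exact: measurableI.
have lower : ((2 * DK * lam)%:E * mu (A `&` H) <= \int[mu]_(y in A) (w y)%:E)%E.
  apply: (le_trans _ (integral_le_subset mu mw w0 mAH mA (@subIsetl _ _ _))).
  apply: cst_le_integral => //; first by rewrite !mulr_ge0// ltW.
  by move=> x [_ /HH0[_ /ltW]].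
have mAHm : (m%:E <= mu (A `&` H))%E.
  by apply: mlb => // x Ex; split; [exact: EA|exact: EH].
have VHe : (mu V <= (m + e)%:E)%E.
  apply: le_trans (Ureg V mV VU) _; apply: le_trans (leeD2r _ Hm) _.
  by rewrite -EFinD lee_fin; lra.
have : ((2 * DK * lam * m)%:E <= (DK * lam * (m + e))%:E)%E.
  rewrite (EFinM (2 * DK * lam)); apply: (@le_trans _ _ ((2 * DK * lam)%:E * mu (A `&` H))%E).
    by apply: lee_wpmul2l => //; rewrite lee_fin !mulr_ge0// ltW.
  apply: le_trans lower _; apply: le_trans AV _.
  by rewrite (EFinM (DK * lam)); apply: lee_wpmul2l => //; rewrite lee_fin mulr_ge0// ltW.
have DKl : 0 < DK * lam by exact: mulr_gt0.
rewrite lee_fin -mulrA -mulrA (mulrA DK) mulrCA ler_pM2l//; lra.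
Qed.

End differentiation.

(** * The weak-type estimate for A_infinity weights *)

Section weak_type.
Context {d : measure_display} {T : measurableType d} {R : realType}.
Variable mu : {measure set T -> \bar R}.
Variable rho : T -> T -> R.

Definition mean (w : T -> R) x r : R :=
  fine (\int[mu]_(y in qball rho x r) (w y)%:E) / fine (mu (qball rho x r)).

(** The last field is the A_infinity condition: on no ball is [w] much smaller
than its mean except on a small proportion of the ball.  The function [eta]
records the dependence of constants, which must be uniform over families of
weights. *)
Record is_Ainfty (eta : R -> R) (w : T -> R) : Prop := IsAinfty {
  Ainfty_measurable : measurable_fun setT w ;
  Ainfty_ge0 : forall x, 0 <= w x ;
  Ainfty_pos : forall x (r : R), 0 < r ->
    (0 < \int[mu]_(y in qball rho x r) (w y)%:E)%E ;
  Ainfty_fin : forall x (r : R), 0 < r ->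
    (\int[mu]_(y in qball rho x r) (w y)%:E < +oo)%E ;
  Ainfty_small : forall theta x (r : R), 0 < theta -> 0 < r ->
    (mu (qball rho x r `&` [set y | (w y < eta theta * mean w x r)%R]) <=
     theta%:E * mu (qball rho x r))%E }.

Context {c D : R} (hom : is_homogeneous mu rho c D).
Variable eta : R -> R.
Hypothesis eta0 : forall theta, 0 < theta -> 0 < eta theta.

Section weight.
Variable w : T -> R.
Hypothesis Aw : is_Ainfty eta w.
Let mw := Ainfty_measurable Aw.
Let w0 := Ainfty_ge0 Aw.

Lemma mean_gt0 x (r : R) : 0 < r -> 0 < mean w x r.
Proof.
move=> r0; rewrite divr_gt0 ?(qball_fine_gt0 hom)// fine_gt0//.
by rewrite (Ainfty_pos Aw)//= (Ainfty_fin Aw).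
Qed.

Lemma integral_meanE x (r : R) : 0 < r ->
  (\int[mu]_(y in qball rho x r) (w y)%:E = (mean w x r)%:E * mu (qball rho x r))%E.
Proof.
move=> r0; rewrite (qball_measureE hom)// -EFinM divfK ?fineK//.
  by rewrite ge0_fin_numE ?(Ainfty_fin Aw)// ltW// (Ainfty_pos Aw).
by rewrite gt_eqF// (qball_fine_gt0 hom).
Qed.

Lemma Ainfty_large theta x (r : R) : 0 < theta -> 0 < r ->
  ((1 - theta)%:E * mu (qball rho x r) <=
   mu (qball rho x r `&` [set y | (eta theta * mean w x r <= w y)%R]))%E.
Proof.
move=> t0 r0; apply: large_part => //; first exact: (hom_measurable hom).
  exact: (hom_fin hom).
exact: (Ainfty_small Aw).
Qed.

Lemma qball_cancel x (r a b : R) : 0 < r ->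
  (a%:E * mu (qball rho x r) <= b%:E * mu (qball rho x r))%E -> a <= b.
Proof.
move=> r0; rewrite (qball_measureE hom)// -!EFinM lee_fin ler_pM2r//.
exact: (qball_fine_gt0 hom).
Qed.

(** The measure [w dmu] is doubling: on the small ball, at least half of the
points have [w] at least a fixed multiple of the mean over the large ball, because
the exceptional set is a small proportion of the large ball, hence of the small
one. *)
Lemma mean_dilation (K DK : R) x (r : R) : 1 <= K -> 0 < DK -> 0 < r ->
  (mu (qball rho x (K * r)) <= DK%:E * mu (qball rho x r))%E ->
  mean w x (K * r) <= 2 / eta (2 * DK)^-1 * mean w x r /\
  mean w x r <= DK * mean w x (K * r).
Proof.
move=> K1 DK0 r0 DKr; have K0 : 0 < K by exact: lt_le_trans K1.
have Kr0 : 0 < K * r by exact: mulr_gt0.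
have sub : qball rho x r `<=` qball rho x (K * r).
  by apply: le_qball; rewrite ler_peMl// ltW.
have mB := hom_measurable hom x r0; have mBK := hom_measurable hom x Kr0.
(* an exceptional set filling 1 / (2 DK) of the large ball
   fills at most half of the small one *)
have t0 : 0 < (2 * DK)^-1 by rewrite invr_gt0 mulr_gt0.
split.
  set a := eta (2 * DK)^-1 * mean w x (K * r).
  have a0 : 0 < a by rewrite mulr_gt0 ?eta0 ?mean_gt0.
  have : ((a / 2)%:E * mu (qball rho x r) <= (mean w x r)%:E * mu (qball rho x r))%E.
    rewrite -integral_meanE//.
    have mBa : measurable (qball rho x r `&` [set y | a <= w y]).
      by apply: measurableI => //; exact: measurable_ge.
    apply: (le_trans _ (integral_le_subset mu mw w0 mBa mB (@subIsetl _ _ _))).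
    apply: (@le_trans _ _ (a%:E * mu (qball rho x r `&` [set y | (a <= w y)%R]))%E); last first.
      apply: cst_le_integral => //.
      - exact: ltW.
      - by move=> y [].
    rewrite EFinM -muleA; apply: lee_wpmul2l; first by rewrite lee_fin ltW.
    rewrite (_ : 2^-1 = 1 - 2^-1 :> R); last lra.
    apply: large_part => //; first exact: (hom_fin hom).
    apply: (@le_trans _ _ (mu (qball rho x (K * r) `&` [set y | (w y < a)%R]))).
      apply: le_measure; rewrite ?inE.
      - by apply: measurableI => //; exact: measurable_lt.
      - by apply: measurableI => //; exact: measurable_lt.
      - exact: setSI.
    apply: le_trans (Ainfty_small Aw x t0 Kr0) _.
    apply: (@le_trans _ _ ((2 * DK)^-1%:E * (DK%:E * mu (qball rho x r)))%E).
      by apply: lee_wpmul2l => //; rewrite lee_fin ltW.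
    by rewrite muleA -EFinM invfM -mulrA mulVf ?mulr1// gt_eqF.
  move=> /(qball_cancel r0); rewrite /a => h.
  by rewrite mulrAC ler_pdivlMr ?eta0// mulrC; lra.
apply: (qball_cancel r0 (x := x)); rewrite -integral_meanE//.
apply: le_trans (integral_le_subset mu mw w0 mB mBK sub) _.
rewrite integral_meanE// [DK * _]mulrC (EFinM (mean _ _ _)) -muleA; apply: lee_wpmul2l => //.
by rewrite lee_fin ltW// mean_gt0.
Qed.

Lemma mean_le_of_sub (x y : T) (r s Q : R) : 0 < r -> 0 < s ->
  qball rho x r `<=` qball rho y s -> 0 <= Q ->
  (mu (qball rho y s) <= Q%:E * mu (qball rho x r))%E ->
  mean w x r <= Q * mean w y s.
Proof.
move=> r0 s0 sub Q0 muQ; apply: (qball_cancel r0 (x := x)).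
rewrite -integral_meanE//.
apply: le_trans (integral_le_subset mu mw w0 _ _ sub) _.
- exact: (hom_measurable hom).
- exact: (hom_measurable hom).
rewrite integral_meanE// [Q * _]mulrC (EFinM (mean _ _ _)) -muleA; apply: lee_wpmul2l => //.
by rewrite lee_fin ltW// mean_gt0.
Qed.

(** Among the radii with mean above [lam], any one larger than half of their
supremum will do. *)
Lemma stopping_radius (x : T) (lam r0 K : R) : 2 < K -> 0 < r0 ->
  (forall r, r0 / K <= r -> r <= r0 -> mean w x r <= lam) ->
  (exists2 r, 0 < r <= r0 & lam < mean w x r) ->
  exists r, [/\ 0 < r, r <= r0, lam < mean w x r & mean w x (K * r) <= lam].
Proof.
move=> K2 r00 big [r1 r10 lr1].
pose S := [set r | 0 < r <= r0 /\ lam < mean w x r].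
have Sr1 : S r1 by [].
have hsS : has_sup S.
  by split; [exists r1|exists r0 => r [/andP[]]].
have r1s : r1 <= sup S by apply: ub_le_sup => //; case: hsS.
have s0 : 0 < sup S / 2 by case/andP: r10; lra.
have [r [/andP[rp rr0] lr] sr] := sup_adherent s0 hsS.
exists r; split => //; rewrite leNgt; apply/negP => lKr.
have K0 : 0 < K by lra.
have rK : r < r0 / K.
  by rewrite ltNge; apply/negP => /big /(_ rr0); rewrite leNgt lr.
have SKr : S (K * r).
  by split => //; rewrite mulr_gt0//= mulrC -ler_pdivlMr// ltW.
have : K * r <= sup S by apply: ub_le_sup => //; case: hsS.
apply/negP; rewrite -ltNge; have : 2 * r < K * r by rewrite ltr_pM2r.
lra.
Qed.

End weight.

(** The constants depend on [w] only through [eta].  The first three conclusions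
are the doubling properties needed to compare the ball with its enlargement. *)
Lemma weak_type_estimate : exists C0 C1 C2 e1 CD : R,
  [/\ 1 <= C0, 1 <= C1, 1 <= C2, 0 < e1 <= 1 & 1 <= CD] /\
  forall w, is_Ainfty eta w -> forall x0 (r0 : R), 0 < r0 ->
  [/\ mean w x0 (2 * c * r0) <= CD * mean w x0 r0,
      mean w x0 r0 <= CD * mean w x0 (2 * c * r0),
      (mu (qball rho x0 (2 * c * r0)) <= CD%:E * mu (qball rho x0 r0))%E &
      forall lam, C0 * mean w x0 r0 <= lam ->
      (\int[mu]_(y in qball rho x0 r0 `&` [set y | (C1 * lam < w y)%R]) (w y)%:E <=
       (C2 * lam)%:E *
         mu (qball rho x0 (2 * c * r0) `&` [set y | (e1 * lam < w y)%R]))%E].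
Proof.
have c1 := hom_c hom; have c0 : 0 < c by exact: lt_le_trans c1.
have [K KE] : exists K, K = 3 * c by exists (3 * c).
have K3 : 3 <= K by rewrite KE ler_peMr.
have K0 : 0 < K by lra.
have [DK DK1 DKP] := qball_dilation hom K.
have [D2 D21 D2P] := qball_dilation hom (2 * c).
have [D3 D31 D3P] := qball_dilation hom (2 * c * (2 * c) * K).
have DK0 : 0 < DK by exact: lt_le_trans DK1.
have D20 : 0 < D2 by exact: lt_le_trans D21.
have D30 : 0 < D3 by exact: lt_le_trans D31.
pose A2 := 2 / eta (2 * D2)^-1.
have A20 : 0 < A2 by rewrite divr_gt0// eta0// invr_gt0 mulr_gt0.
pose e1 := Num.min (eta 2^-1) 1.
have e10 : 0 < e1 by rewrite lt_min eta0//= ?ltr01.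
exists (Num.max 1 (D3 * A2)), (2 * DK), (2 * DK), e1, (Num.max A2 D2).
split; first split.
- by rewrite le_max lexx.
- lra.
- lra.
- by rewrite e10 ge_min lexx orbT.
- by rewrite le_max D21 orbT.
move=> w Aw x0 r0 r00.
have mw := Ainfty_measurable Aw; have w0 := Ainfty_ge0 Aw.
have c21 : 1 <= 2 * c by lra.
have cr0 : 0 < 2 * c * r0 by rewrite !mulr_gt0.
have m0 := mean_gt0 Aw x0 r00; have mc0 := mean_gt0 Aw x0 cr0.
have [mA mB] := mean_dilation Aw c21 D20 r00 (D2P x0 r0 r00).
split.
- by apply: le_trans mA _; rewrite ler_pM2r// le_max lexx.
- by apply: le_trans mB _; rewrite ler_pM2r// le_max lexx orbT.
- apply: le_trans (D2P x0 r0 r00) _; apply: lee_wpmul2r => //.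
  by rewrite lee_fin le_max lexx orbT.
move=> lam lamge.
have lam0 : 0 < lam.
  by apply: lt_le_trans lamge; rewrite mulr_gt0// lt_max ltr01.
(* balls with centre in the given one and radius comparable to r0 have
   small mean, so that the stopping radius is below r0 / K *)
have big x r : qball rho x0 r0 x -> r0 / K <= r -> r <= r0 -> mean w x r <= lam.
  move=> xB rK rr0; have rp : 0 < r by apply: lt_le_trans rK; rewrite divr_gt0.
  apply: le_trans lamge.
  apply: (@le_trans _ _ (D3 * mean w x0 (2 * c * r0))).
    apply: mean_le_of_sub => //; last 1 first.
    - apply: (@le_trans _ _ (mu (qball rho x (2 * c * (2 * c) * K * r)))); last exact: D3P.
      have h : 2 * c * (2 * c * r0) <= 2 * c * (2 * c) * K * r.
        rewrite -!mulrA ler_pM2l// ler_pM2l// ler_pM2l// ler_pM2l//.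
        by rewrite mulrC -ler_pdivrMr.
      have h0 : 0 < 2 * c * (2 * c) * K * r by rewrite !mulr_gt0.
      apply: le_measure; rewrite ?inE.
      + exact: (hom_measurable hom).
      + exact: (hom_measurable hom).
      + apply: subset_trans (le_qball h).
        rewrite (_ : 2 * c * (2 * c * r0) = c * (2 * c * r0 + 2 * c * r0)); last by ring.
        apply: (qball_sub hom); rewrite (hom_sym hom).
        by apply: (le_trans (ltW xB)); rewrite ler_peMl// ltW.
    - rewrite -[2 * c]mulrC -mulrA [2 * r0]mulr_natl.
      apply: subset_trans (qball_sub hom (ltW xB) (r := r0)).
      exact: le_qball.
    - exact: ltW.
  apply: (@le_trans _ _ (D3 * A2 * mean w x0 r0)).
    by rewrite -(mulrA D3 A2) ler_pM2l.
  by rewrite ler_pM2r// le_max lexx orbT.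
(* E is the set of points that admit a stopping radius; the points of large w
   outside E are negligible, by differentiation up to a constant *)
pose E := [set x | qball rho x0 r0 x /\ exists2 r, 0 < r <= r0 & lam < mean w x r].
pose N := [set x | [/\ qball rho x0 r0 x, 2 * DK * lam < w x &
  forall r, 0 < r -> r <= r0 -> mean w x r <= lam]].
have Nnegl : mu.-negligible N.
  apply: (small_means_negligible hom mw w0 DK1 (lam := lam) (x0 := x0) (r0 := r0) (r1 := r0)) => //.
  - by move=> x r rp; rewrite -KE; exact: DKP.
  - by move=> x [].
  - by move=> x [].
  - move=> x r [_ _ +] rp rr0 => /(_ r rp rr0) ml.
    by rewrite (integral_meanE Aw)//; apply: lee_wpmul2r => //; rewrite lee_fin.
have /choice[r rP] : forall x, exists r, E x ->
    [/\ 0 < r, r <= r0, lam < mean w x r & mean w x (K * r) <= lam].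
  move=> x; have [Ex|nEx] := pselect (E x); last by exists 0.
  have K2 : 2 < K by lra.
  have [r rP] := stopping_radius K2 r00 (fun r => @big x r Ex.1) Ex.2.
  by exists r.
have mG : measurable (qball rho x0 (2 * c * r0)) by exact: (hom_measurable hom).
have [| |A [V [[mA' mV EA VE] AV]]] := @vitali_bound _ T R mu rho c D hom E _ r r0 mG (hom_fin hom x0 cr0).
- by move=> x Ex; have [-> ->] := rP x Ex.
- move=> x Ex; have [_ rr0 _ _] := rP x Ex.
  rewrite -[2 * c]mulrC -mulrA [2 * r0]mulr_natl.
  by apply: subset_trans (qball_sub hom (ltW Ex.1) (r := r0)); exact: le_qball.
have mL := measurable_gt mw (e1 * lam).
set L := [set y | _ < w y] in mL *.
have mBL : measurable (qball rho x0 r0 `&` [set y | 2 * DK * lam < w y]).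
  by apply: measurableI; [exact: (hom_measurable hom)|exact: measurable_gt].
apply: (@le_trans _ _ (\int[mu]_(y in A) (w y)%:E)%E).
  apply: (integral_le_subset_negligible mw w0 mBL mA' _ Nnegl) => x [xB /= wx].
  have [Ex|nEx] := pselect (E x); first by left; exact: EA.
  right; split => // s s0 sr0; rewrite leNgt; apply/negP => ls.
  by apply: nEx; split => //; exists s => //; rewrite s0.
apply: (@le_trans _ _ ((2 * DK * lam)%:E * mu (V `&` L))%E); last first.
  apply: lee_wpmul2l; first by rewrite lee_fin !mulr_ge0// ltW.
  apply: le_measure; rewrite ?inE; [exact: measurableI|exact: measurableI|].
  apply: setSI => y /VE[x Ex]; have [_ rr0 _ _] := rP x Ex.
  move=> /(le_qball rr0) /(qball_sub hom (ltW Ex.1)).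
  by rewrite (_ : c * (r0 + r0) = 2 * c * r0)//; ring.
apply: AV => //; first exact: measurable_EFin_setT.
move=> x Ex; have [rx0 rr0 lr lKr] := rP x Ex.
have Krx0 : 0 < K * r x by rewrite mulr_gt0.
rewrite -KE (integral_meanE Aw)//.
apply: (@le_trans _ _ (lam%:E * (DK%:E * mu (qball rho x (r x))))%E).
  apply: (@le_trans _ _ (lam%:E * mu (qball rho x (K * r x)))%E).
    by apply: lee_wpmul2r => //; rewrite lee_fin.
  by apply: lee_wpmul2l; [rewrite lee_fin ltW|exact: DKP].
rewrite (_ : (2 * DK * lam)%:E = lam%:E * (DK%:E * 2%:E))%E; last first.
  by rewrite -!EFinM; congr _%:E; ring.
rewrite -[leRHS]muleA; apply: lee_wpmul2l; first by rewrite lee_fin ltW.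
rewrite -muleA; apply: lee_wpmul2l; first by rewrite lee_fin ltW.
apply: (@le_trans _ _ (2%:E * ((1 - 2^-1)%:E * mu (qball rho x (r x))))%E).
  by rewrite muleA -EFinM (_ : 2 * (1 - 2^-1) = 1 :> R) ?mul1e//; lra.
apply: lee_wpmul2l => //.
have t20 : 0 < 2^-1 :> R by rewrite invr_gt0.
apply: le_trans (Ainfty_large Aw x t20 rx0) _.
apply: le_measure; rewrite ?inE.
- apply: measurableI; [exact: (hom_measurable hom)|exact: measurable_ge].
- by apply: measurableI => //; exact: (hom_measurable hom).
- apply: setIS => y /=; apply: lt_le_trans.
  apply: (@lt_le_trans _ _ (e1 * mean w x (r x))); first by rewrite ltr_pM2l.
  rewrite ler_pM2r ?(mean_gt0 Aw)//.
  by rewrite ge_min lexx.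
Qed.

End weak_type.

(** * The reverse Hoelder inequality *)

Section truncated_powers.
Context {R : realType}.
Implicit Types (y l e eps : R) (n : nat).

Lemma le_powR (a b e : R) : 0 <= e -> 0 <= a -> a <= b -> a `^ e <= b `^ e.
Proof.
move=> e0 a0 ab; apply: ge0_ler_powR => //; rewrite nnegrE//.
exact: le_trans ab.
Qed.

(** The truncation acts on the factor [y ^ eps] alone, so that the remaining
factor [y] can be integrated against the sets where the weight is large. *)
Definition truncpow (eps l : R) (n : nat) (y : R) : R :=
  (Num.min y (2 ^+ n * l)) `^ eps * y.

Let lev0 l n : 0 < l -> 0 < 2 ^+ n * l.
Proof. by move=> l0; rewrite mulr_gt0// exprn_gt0. Qed.

Lemma truncpow_ge0 eps l n y : 0 <= y -> 0 <= truncpow eps l n y.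
Proof. by move=> y0; rewrite mulr_ge0// powR_ge0. Qed.

Lemma le_truncpow eps l m n y : 0 <= eps -> 0 < l -> 0 <= y -> (m <= n)%N ->
  truncpow eps l m y <= truncpow eps l n y.
Proof.
move=> e0 l0 y0 mn; rewrite ler_wpM2r//.
apply: le_powR => //; first by rewrite le_min y0 ltW//; exact: lev0.
rewrite le_min !ge_min lexx/=; apply/orP; right.
by rewrite ler_pM2r// ler_eXn2l// ltr1n.
Qed.

(** Raising the truncation level from [2 ^ n l] to [2 ^ n.+1 l] multiplies the
truncated factor by at most [2 ^ eps], and only where [y] exceeds the lower
level. *)
Lemma truncpowS eps l n y : 0 <= eps -> 0 < l -> 0 <= y ->
  truncpow eps l n.+1 y <= truncpow eps l n y +
    (2 `^ eps - 1) * (2 ^+ n * l) `^ eps * (if 2 ^+ n * l < y then y else 0).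
Proof.
move=> e0 l0 y0; rewrite /truncpow; have ln := lev0 n l0.
have lS : 2 ^+ n.+1 * l = 2 * (2 ^+ n * l) by rewrite exprS mulrA.
case: ltP => yl.
  rewrite -mulrDl; apply: ler_wpM2r => //.
  rewrite mulrBl mul1r addrC subrK -powRM ?(ltW ln)// -lS.
  apply: le_powR => //; first by rewrite le_min y0 ltW//; exact: lev0.
  by rewrite ge_min lexx orbT.
rewrite mulr0 addr0 (min_idPl _)//.
by apply: le_trans yl _; rewrite lS ler_peMl// ltW// ltr1n.
Qed.

Lemma geometric_levels eps l n : 0 <= eps -> 0 < l ->
  \sum_(k < n.+1) (2 ^+ k * l) `^ (1 + eps) <= 2 * (2 ^+ n * l) `^ (1 + eps).
Proof.
move=> e0 l0; elim: n => [|n IH].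
  by rewrite big_ord_recr big_ord0/= add0r ler_peMl ?powR_ge0// ler1n.
rewrite big_ord_recr/=; apply: le_trans (lerD IH (lexx _)) _.
rewrite [leRHS]mulr_natl mulr2n lerD2r exprS -mulrA [leRHS]powRM ?(ltW (lev0 n l0))//.
rewrite ler_wpM2r ?powR_ge0//; apply: le1r_powR; first lra.
by rewrite lerDl.
Qed.

(** The levels below [y / e] form a geometric progression, so that their sum is
comparable with the largest of them. *)
Lemma sum_levels_le_truncpow eps l e n y : 0 <= eps -> eps <= 1 -> 0 < l ->
  0 < e -> e <= 1 -> 0 <= y ->
  \sum_(k < n.+1) (2 ^+ k * l) `^ (1 + eps) * ((e * (2 ^+ k * l) < y)%R)%:R
    <= 2 / e ^+ 2 * truncpow eps l n y.
Proof.
move=> e0 e1 l0 ep ep1 y0.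
have big k : e * (2 ^+ k * l) < y ->
    \sum_(k < k.+1) (2 ^+ k * l) `^ (1 + eps) * ((e * (2 ^+ k * l) < y)%R)%:R
    <= 2 / e ^+ 2 * truncpow eps l k y.
  move=> ky; apply: (@le_trans _ _ (\sum_(k < k.+1) (2 ^+ k * l) `^ (1 + eps))).
    by apply: ler_sum => i _; rewrite ler_piMr ?powR_ge0// lern1 leq_b1.
  apply: le_trans (geometric_levels _ e0 l0) _.
  rewrite -mulrA ler_pM2l// ler_pdivlMl ?exprn_gt0//.
  have lk := lev0 k l0.
  rewrite [1 + eps]addrC powRD; last by rewrite (gt_eqF lk) implybT.
  rewrite powRr1 ?(ltW lk)// expr2 /truncpow.
  rewrite (_ : e * e * _ = (e * (2 ^+ k * l) `^ eps) * (e * (2 ^+ k * l))); last by ring.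
  apply: ler_pM; [by rewrite mulr_ge0 ?powR_ge0// ltW|by rewrite mulr_ge0// ltW| |exact: ltW].
  apply: (@le_trans _ _ ((e * (2 ^+ k * l)) `^ eps)).
    rewrite [leRHS]powRM ?(ltW ep) ?(ltW lk)// ler_wpM2r ?powR_ge0//.
    rewrite -[leLHS]powRr1 ?(ltW ep)//; by apply: ger_powR => //; rewrite ep ep1.
  apply: le_powR => //; first by rewrite mulr_ge0// ltW.
  by rewrite le_min (ltW ky) ler_piMl// ltW.
elim: n => [|n IH].
  have [|ny] := boolP (e * (2 ^+ 0 * l) < y); first exact: big.
  rewrite big_ord_recr big_ord0/= (negbTE ny) mulr0 addr0.
  by rewrite mulr_ge0 ?truncpow_ge0// divr_ge0// exprn_ge0// ltW.
have [|ny] := boolP (e * (2 ^+ n.+1 * l) < y); first exact: big.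
rewrite big_ord_recr/= (negbTE ny) mulr0 addr0; apply: le_trans IH _.
by rewrite ler_pM2l ?divr_gt0 ?exprn_gt0// le_truncpow.
Qed.

Lemma truncpow_level eps l l' C n y : 0 <= eps -> eps <= 1 -> 0 < l -> 0 < l' ->
  1 <= C -> l <= C * l' -> 0 <= y ->
  truncpow eps l n y <= C * truncpow eps l' n y.
Proof.
move=> e0 e1 l0 l'0 C1 lC y0.
have C0 : 0 < C by exact: lt_le_trans C1.
rewrite /truncpow mulrA ler_wpM2r//.
have mge : 0 <= Num.min y (2 ^+ n * l') by rewrite le_min y0 ltW//; exact: lev0.
apply: (@le_trans _ _ ((C * Num.min y (2 ^+ n * l')) `^ eps)).
  apply: le_powR => //; first by rewrite le_min y0 ltW//; exact: lev0.
  rewrite minr_pMr ?(ltW C0)// le_min !ge_min ler_peMl//=; apply/orP; right.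
  by rewrite mulrCA ler_pM2l// exprn_gt0.
by rewrite powRM ?(ltW C0)// ler_wpM2r ?powR_ge0// ler1_powR.
Qed.

(** The factor [2 ^ eps - 1] is what makes the error term absorbable. *)
Lemma two_powR_sub1 eps : 0 <= eps -> eps <= 2^-1 -> 2 `^ eps - 1 <= 2 * eps.
Proof.
move=> e0 e2; rewrite /powR pnatr_eq0/=.
have l2 : ln 2 <= 1 :> R.
  by rewrite (_ : 2 = 1 + 1); [exact: le_ln1Dx|]; lra.
have l20 : 0 <= ln 2 :> R by rewrite ln_ge0// ler1n.
have h := expR_ge1Dx (- (eps * ln 2)); rewrite expRN in h.
have el : eps * ln 2 <= eps by rewrite ler_piMr.
have E0 := expR_gt0 (eps * ln 2); set E := expR _ in h E0 *.
have : (1 - eps) * E <= 1.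
  apply: (@le_trans _ _ (E^-1 * E)); last by rewrite mulVf// gt_eqF.
  by rewrite ler_pM2r//; lra.
have : (1 - eps) * E <= (1 - eps) * (1 + 2 * eps) -> E - 1 <= 2 * eps.
  by rewrite ler_pM2l; lra.
nra.
Qed.

End truncated_powers.

Section reverse_holder.
Context {d : measure_display} {T : measurableType d} {R : realType}.
Variable mu : {measure set T -> \bar R}.
Variable rho : T -> T -> R.

Lemma measurable_truncpow (w : T -> R) (eps l : R) n :
  measurable_fun setT w -> measurable_fun setT (fun y => truncpow eps l n (w y)).
Proof.
move=> mw; apply: measurable_funM => //.
apply: (measurableT_comp (measurable_powR eps)).
exact: measurable_minr.
Qed.

Lemma integral_truncpowS (w : T -> R) (B : set T) (eps l : R) n :
  measurable_fun setT w -> (forall y, 0 <= w y) -> measurable B -> 0 <= eps -> 0 < l ->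
  (\int[mu]_(y in B) (truncpow eps l n.+1 (w y))%:E <=
   \int[mu]_(y in B) (truncpow eps l n (w y))%:E +
   ((2 `^ eps - 1) * (2 ^+ n * l) `^ eps)%:E *
     \int[mu]_(y in B `&` [set y | (2 ^+ n * l < w y)%R]) (w y)%:E)%E.
Proof.
move=> mw w0 mB e0 l0; set b := (_ * _ `^ _).
have b0 : 0 <= b.
  rewrite mulr_ge0 ?powR_ge0// subr_ge0.
  have h : 1 <= 2 :> R by rewrite ler1n.
  by have := ler_powR h e0; rewrite powRr0.
set S := [set y | _ < w y].
have mS : measurable S by exact: measurable_gt.
have mwS : measurable_fun B ((EFin \o w) \_ S).
  by apply: measurable_funTS; apply/(measurable_restrictT _ mS).1; apply: measurable_funTS;
     exact: measurable_EFin_setT.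
have wS0 y : (0 <= ((EFin \o w) \_ S) y)%E.
  by rewrite patchE; case: ifP => // _; rewrite lee_fin.
have mt k : measurable_fun B (fun y => (truncpow eps l k (w y))%:E).
  by apply: measurable_funTS; apply/measurable_EFinP; exact: measurable_truncpow.
rewrite integral_mkcondr -ge0_integralZl//.
rewrite -ge0_integralD//; first last.
- exact: measurable_funeM.
- by move=> y _; rewrite mule_ge0// lee_fin.
- by move=> y _; rewrite lee_fin truncpow_ge0.
apply: ge0_le_integral => //.
- by move=> y _; rewrite lee_fin truncpow_ge0.
- apply: emeasurable_funD => //; exact: measurable_funeM.
move=> y _; rewrite patchE.
have := truncpowS n e0 l0 (w0 y); rewrite -/b.
case: ifPn => yS.
  by rewrite mem_set// -EFinM -EFinD lee_fin.
by rewrite memNset ?mule0 ?adde0 ?mulr0 ?addr0 ?lee_fin//; exact/negP.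
Qed.

(** Summation by parts over the dyadic levels of [w]; this replaces the layer
cake formula. *)
Lemma integral_truncpow_levels (w : T -> R) (B : set T) (eps l : R) n :
  measurable_fun setT w -> (forall y, 0 <= w y) -> measurable B -> 0 <= eps -> 0 < l ->
  (\int[mu]_(y in B) (truncpow eps l n (w y))%:E <=
   (l `^ eps)%:E * \int[mu]_(y in B) (w y)%:E + \sum_(k < n)
   ((2 `^ eps - 1) * (2 ^+ k * l) `^ eps)%:E *
     \int[mu]_(y in B `&` [set y | (2 ^+ k * l < w y)%R]) (w y)%:E)%E.
Proof.
move=> mw w0 mB e0 l0; elim: n => [|n IH].
  rewrite big_ord0 adde0 -ge0_integralZl//; first last.
  - by rewrite lee_fin powR_ge0.
  - by move=> y _; rewrite lee_fin.
  - by apply: measurable_funTS; exact: measurable_EFin_setT.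
  apply: ge0_le_integral => //.
  - by move=> y _; rewrite lee_fin truncpow_ge0.
  - by apply: measurable_funTS; apply/measurable_EFinP; exact: measurable_truncpow.
  - by apply: measurable_funeM; apply: measurable_funTS; exact: measurable_EFin_setT.
  move=> y _; rewrite -EFinM lee_fin ler_wpM2r//; apply: le_powR => //.
    by rewrite le_min w0 expr0 mul1r ltW.
  by rewrite ge_min expr0 mul1r lexx orbT.
rewrite big_ord_recr/= addeA; apply: le_trans (integral_truncpowS n mw w0 mB e0 l0) _.
exact: leeD2r.
Qed.

Lemma level_sets_le_integral_truncpow (w : T -> R) (B : set T) (eps l e : R) n :
  measurable_fun setT w -> (forall y, 0 <= w y) -> measurable B ->
  0 <= eps -> eps <= 1 -> 0 < l -> 0 < e -> e <= 1 ->
  (\sum_(k < n.+1) ((2 ^+ k * l) `^ (1 + eps))%:E *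
     mu (B `&` [set y | (e * (2 ^+ k * l) < w y)%R]) <=
   (2 / e ^+ 2)%:E * \int[mu]_(y in B) (truncpow eps l n (w y))%:E)%E.
Proof.
move=> mw w0 mB e0 e1 l0 ep ep1.
have mt : measurable_fun B (fun y => (truncpow eps l n (w y))%:E).
  by apply: measurable_funTS; apply/measurable_EFinP; exact: measurable_truncpow.
rewrite -ge0_integralZl//; first last.
- by rewrite lee_fin divr_ge0// exprn_ge0// ltW.
- by move=> y _; rewrite lee_fin truncpow_ge0.
have mL k : measurable [set y | e * (2 ^+ k * l) < w y] by exact: measurable_gt.
have mi k : measurable_fun B (fun y => (\1_([set y | e * (2 ^+ k * l) < w y]) y)%:E : \bar R).
  apply: measurable_funTS; apply/measurable_EFinP; exact: measurable_indic.
rewrite (eq_bigr (fun k : 'I_n.+1 => (\int[mu]_(y in B)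
  (((2 ^+ k * l) `^ (1 + eps))%:E * (\1_([set y | (e * (2 ^+ k * l) < w y)%R]) y)%:E))%E)); last first.
  move=> k _; rewrite ge0_integralZl//.
  - by rewrite integral_indic// setIC.
  - by rewrite lee_fin powR_ge0.
have mki (k : 'I_n.+1) : measurable_fun B (fun y => ((2 ^+ k * l) `^ (1 + eps))%:E *
    (\1_([set y | (e * (2 ^+ k * l) < w y)%R]) y)%:E)%E.
  exact: measurable_funeM.
have ki0 (k : 'I_n.+1) y : (0 <= ((2 ^+ k * l) `^ (1 + eps))%:E *
    (\1_([set y | (e * (2 ^+ k * l) < w y)%R]) y)%:E)%E.
  by rewrite -EFinM lee_fin mulr_ge0// powR_ge0.
rewrite -ge0_integral_sum//.
apply: ge0_le_integral => //.
- by move=> y _; apply: sume_ge0.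
- exact: emeasurable_sum.
- exact: measurable_funeM.
move=> y _; under eq_bigr do rewrite -EFinM; rewrite sumEFin -EFinM lee_fin.
apply: le_trans (sum_levels_le_truncpow n e0 e1 l0 ep ep1 (w0 y)).
apply: ler_sum => k _; rewrite indicE; have [h|h] := boolP (e * (2 ^+ k * l) < w y).
  by rewrite mem_set.
by rewrite memNset//; exact/negP.
Qed.

Context {c D : R} (hom : is_homogeneous mu rho c D).
Variable eta : R -> R.
Hypothesis eta0 : forall theta, 0 < theta -> 0 < eta theta.

(** Induction on the truncation level, for all balls simultaneously.  On a ball
[B] of mean [a], the integral at level [n.+1] splits into the part below the
first level, bounded by a multiple of [a ^ (1 + eps)], and a sum over levels.
The weak-type estimate and [level_sets_le_integral_truncpow] bound that sum by
[2 ^ eps - 1] times the integral at level [n] over the enlarged ball, to which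
the induction hypothesis applies.  The choice of [eps] makes this second part at
most half of the claimed bound. *)
Lemma truncated_reverse_holder : exists eps M L : R,
  [/\ 0 < eps <= 1, 0 < M, 0 < L & forall w, is_Ainfty mu rho eta w ->
    forall n x (r : R), 0 < r ->
    (\int[mu]_(y in qball rho x r)
       (truncpow eps (L * mean mu rho w x r) n (w y))%:E <=
     (M * mean mu rho w x r `^ (1 + eps))%:E * mu (qball rho x r))%E].
Proof.
have [C0 [C1 [C2 [e1 [CD [[C01 C11 C21 /andP[e10 e11] CD1] weak]]]]]] := weak_type_estimate hom eta0.
have C00 : 0 < C0 by lra.
have C10 : 0 < C1 by lra.
have C20 : 0 < C2 by lra.
have CD0 : 0 < CD by lra.
have [e eE] : exists e, e = e1 / C1 by exists (e1 / C1).
have ep : 0 < e by rewrite eE divr_gt0.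
have ep1 : e <= 1 by rewrite eE ler_pdivrMr// mul1r; lra.
(* X collects the constants met when passing to the enlarged ball and back *)
have [X XE] : exists X, X = C2 * (2 / e ^+ 2) * CD * (CD * (CD * CD)) by eexists.
have X0 : 0 < X by rewrite XE !mulr_gt0// invr_gt0 exprn_gt0.
pose eps := Num.min 2^-1 (4 * X)^-1.
have eps0 : 0 < eps by rewrite lt_min !invr_gt0 ltr0n mulr_gt0.
have eps2 : eps <= 2^-1 by rewrite ge_min lexx.
have eps1 : eps <= 1 by lra.
have epsX : (2 `^ eps - 1) * X <= 2^-1.
  apply: (@le_trans _ _ (2 * eps * X)).
    by rewrite ler_pM2r//; apply: two_powR_sub1 => //; exact: ltW.
  have : eps * (4 * X) <= 1.
    by rewrite -ler_pdivlMr ?mulr_gt0// mul1r ge_min lexx orbT.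
  lra.
have b0 : 0 <= 2 `^ eps - 1.
  have h : 1 <= 2 :> R by rewrite ler1n.
  by have := ler_powR h (ltW eps0); rewrite powRr0 subr_ge0.
have [L LE] : exists L, L = C1 * C0 by eexists.
have L0 : 0 < L by rewrite LE mulr_gt0.
have L1 : 1 <= L by rewrite LE -[1]mulr1 ler_pM.
exists eps, (2 * L), L; split; rewrite ?eps0 ?mulr_gt0//.
move=> w Aw.
have mw := Ainfty_measurable Aw; have w0 := Ainfty_ge0 Aw.
have mg x (r : R) : 0 < r -> 0 < mean mu rho w x r by move=> ?; exact: (mean_gt0 hom Aw).
have aE x (r : R) : 0 < r ->
    mean mu rho w x r `^ (1 + eps) = mean mu rho w x r `^ eps * mean mu rho w x r.
  move=> r0; rewrite addrC powRD ?powRr1//; first exact/ltW/mg.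
  by rewrite (gt_eqF (mg _ _ r0)) implybT.
have first_term x (r : R) : 0 < r ->
    (((L * mean mu rho w x r) `^ eps)%:E * \int[mu]_(y in qball rho x r) (w y)%:E <=
     (L * mean mu rho w x r `^ (1 + eps))%:E * mu (qball rho x r))%E.
  move=> r0; rewrite (integral_meanE hom Aw)// muleA -EFinM; apply: lee_wpmul2r => //.
  rewrite lee_fin aE// mulrA ler_pM2r ?mg// powRM ?(ltW L0) ?(ltW (mg _ _ r0))//.
  by rewrite ler_wpM2r ?powR_ge0// ler1_powR.
elim=> [|n IH] x r r0.
  apply: le_trans (integral_truncpow_levels 0 mw w0 _ (ltW eps0) _) _.
  - exact: (hom_measurable hom).
  - by rewrite mulr_gt0// mg.
  rewrite big_ord0 adde0; apply: le_trans (first_term x r r0) _.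
  apply: lee_wpmul2r => //; rewrite lee_fin ler_wpM2r ?powR_ge0//.
  by rewrite ler_peMl// ?ler1n// ltW.
have c0 : 0 < c by exact: lt_le_trans (hom_c hom).
have cr0 : 0 < 2 * c * r by rewrite !mulr_gt0.
have [ma mb mub wk] := weak w Aw x r r0.
set B := qball rho x r; set Bs := qball rho x (2 * c * r) in mub wk.
set a := mean mu rho w x r; set a' := mean mu rho w x (2 * c * r) in ma mb.
have a0 : 0 < a by exact: mg.
have a'0 : 0 < a' by exact: mg.
have l0 : 0 < L * a by exact: mulr_gt0.
have mB : measurable B by exact: (hom_measurable hom).
have mBs : measurable Bs by exact: (hom_measurable hom).
apply: le_trans (integral_truncpow_levels n.+1 mw w0 mB (ltW eps0) l0) _.
apply: le_trans (leeD2r _ (first_term x r r0)) _.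
rewrite -/a -/B.
(* the weak-type estimate is applied at every level; since the truncation levels
   of the ball and of its enlargement are comparable, the induction hypothesis
   on the enlargement then applies *)
have step1 : (\sum_(k < n.+1) ((2 `^ eps - 1) * (2 ^+ k * (L * a)) `^ eps)%:E *
     \int[mu]_(y in B `&` [set y | (2 ^+ k * (L * a) < w y)%R]) (w y)%:E <=
   ((2 `^ eps - 1) * C2)%:E * \sum_(k < n.+1) ((2 ^+ k * (L * a)) `^ (1 + eps))%:E *
     mu (Bs `&` [set y | (e * (2 ^+ k * (L * a)) < w y)%R]))%E.
  rewrite ge0_sume_distrr; last by move=> k _; rewrite mule_ge0// lee_fin powR_ge0.
  apply: lee_sum => k _; set lk := 2 ^+ k * (L * a).
  have lk0 : 0 < lk by rewrite mulr_gt0// exprn_gt0.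
  have := wk (lk / C1).
  have -> : C1 * (lk / C1) = lk by rewrite mulrC divfK// gt_eqF.
  have -> : e1 * (lk / C1) = e * lk by rewrite eE; ring.
  have lkge : C0 * a <= lk / C1.
    rewrite ler_pdivlMr// /lk LE.
    rewrite (_ : _ * (C1 * C0 * a) = 2 ^+ k * (C0 * a * C1)); last by ring.
    rewrite ler_peMl ?exprn_ege1 ?ler1n//.
    exact: mulr_ge0 (mulr_ge0 (ltW C00) (ltW a0)) (ltW C10).
  move=> /(_ lkge) wkk.
  rewrite [1 + eps]addrC powRD; last by rewrite (gt_eqF lk0) implybT.
  rewrite powRr1 ?(ltW lk0)//.
  apply: (@le_trans _ _ (((2 `^ eps - 1) * lk `^ eps)%:E * ((C2 * lk)%:E *
    mu (Bs `&` [set y | (e * lk < w y)%R])))%E).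
    apply: lee_wpmul2l; first by rewrite lee_fin mulr_ge0// powR_ge0.
    apply: le_trans wkk _; apply: lee_wpmul2r => //; rewrite lee_fin.
    by rewrite ler_pM2l// ler_pdivrMr// ler_peMr// ltW.
  rewrite !muleA -!EFinM; apply: lee_wpmul2r => //; rewrite lee_fin.
  by rewrite le_eqVlt; apply/orP; left; apply/eqP; ring.
have step2 := level_sets_le_integral_truncpow n mw w0 mBs (ltW eps0) eps1 l0 ep ep1.
have step3 : (\int[mu]_(y in Bs) (truncpow eps (L * a) n (w y))%:E <=
   CD%:E * \int[mu]_(y in Bs) (truncpow eps (L * a') n (w y))%:E)%E.
  have mt l : measurable_fun Bs (fun y => (truncpow eps l n (w y))%:E).
    by apply: measurable_funTS; apply/measurable_EFinP; exact: measurable_truncpow.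
  rewrite -ge0_integralZl//; first last.
  - by rewrite lee_fin ltW.
  - by move=> y _; rewrite lee_fin truncpow_ge0.
  apply: ge0_le_integral => //.
  - by move=> y _; rewrite lee_fin truncpow_ge0.
  - exact: measurable_funeM.
  move=> y _; rewrite -EFinM lee_fin; apply: truncpow_level => //.
  - exact: ltW.
  - by rewrite mulr_gt0.
  - by rewrite (mulrCA CD) ler_pM2l.
have step4 := IH x (2 * c * r) cr0; rewrite -/Bs -/a' in step4.
have a'_a : a' `^ (1 + eps) <= CD * CD * a `^ (1 + eps).
  apply: (@le_trans _ _ ((CD * a) `^ (1 + eps))).
    by apply: le_powR => //; [lra|exact: ltW].
  rewrite powRM ?(ltW CD0) ?(ltW a0)// ler_wpM2r ?powR_ge0//.
  apply: (@le_trans _ _ (CD `^ 2)); first by apply: ler_powR => //; lra.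
  by rewrite powR_mulrn ?(ltW CD0)// expr2.
have total : (((2 `^ eps - 1) * C2)%:E * \sum_(k < n.+1) ((2 ^+ k * (L * a)) `^ (1 + eps))%:E *
     mu (Bs `&` [set y | (e * (2 ^+ k * (L * a)) < w y)%R]) <=
   (L * a `^ (1 + eps))%:E * mu B)%E.
  apply: (@le_trans _ _ (((2 `^ eps - 1) * C2)%:E * ((2 / e ^+ 2)%:E * (CD%:E *
    ((2 * L * a' `^ (1 + eps))%:E * mu Bs))))%E).
    apply: lee_wpmul2l; first by rewrite lee_fin mulr_ge0// ltW.
    apply: le_trans step2 _; apply: lee_wpmul2l.
      by rewrite lee_fin divr_ge0// exprn_ge0// ltW.
    by apply: le_trans step3 _; apply: lee_wpmul2l => //; rewrite lee_fin ltW.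
  apply: (@le_trans _ _ (((2 `^ eps - 1) * C2)%:E * ((2 / e ^+ 2)%:E * (CD%:E *
    ((2 * L * (CD * CD * a `^ (1 + eps)))%:E * (CD%:E * mu B)))))%E).
    apply: lee_wpmul2l; first by rewrite lee_fin mulr_ge0// ltW.
    apply: lee_wpmul2l; first by rewrite lee_fin divr_ge0// exprn_ge0// ltW.
    apply: lee_wpmul2l; first by rewrite lee_fin ltW.
    apply: (@le_trans _ _ ((2 * L * (CD * CD * a `^ (1 + eps)))%:E * mu Bs)%E).
      by apply: lee_wpmul2r => //; rewrite lee_fin ler_pM2l// mulr_gt0.
    by apply: lee_wpmul2l => //; rewrite lee_fin !mulr_ge0 ?powR_ge0// ltW.
  rewrite !muleA -!EFinM; apply: lee_wpmul2r => //; rewrite lee_fin.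
  rewrite [leLHS](_ : _ = ((2 `^ eps - 1) * X) * (2 * (L * a `^ (1 + eps)))); last first.
    by rewrite XE; ring.
  have La0 : 0 <= 2 * (L * a `^ (1 + eps)) by rewrite !mulr_ge0 ?powR_ge0// ltW.
  apply: le_trans (ler_wpM2r La0 epsX) _.
  by rewrite le_eqVlt; apply/orP; left; apply/eqP; field.
apply: le_trans (leeD2l _ (le_trans step1 total)) _.
rewrite -ge0_muleDl ?lee_fin ?mulr_ge0 ?powR_ge0 ?(ltW L0)// -EFinD.
by apply: lee_wpmul2r => //; rewrite lee_fin -mulrA [leRHS]mulr_natl mulr2n.
Qed.

Theorem reverse_holder : exists eps M : R,
  [/\ 0 < eps, 0 < M & forall w, is_Ainfty mu rho eta w -> forall x (r : R), 0 < r ->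
    (\int[mu]_(y in qball rho x r) (w y `^ (1 + eps))%:E <=
     (M * mean mu rho w x r `^ (1 + eps))%:E * mu (qball rho x r))%E].
Proof.
have [eps [M [L [/andP[eps0 eps1] M0 L0 trh]]]] := truncated_reverse_holder.
exists eps, M; split => // w Aw x r r0.
have mw := Ainfty_measurable Aw; have w0 := Ainfty_ge0 Aw.
have mg : 0 < mean mu rho w x r by exact: (mean_gt0 hom Aw).
set l := L * mean mu rho w x r; have l0 : 0 < l by exact: mulr_gt0.
pose g n y := (truncpow eps l n (w y))%:E.
have nd y : {homo g^~ y : n m / (n <= m)%N >-> (n <= m)%E}.
  by move=> n m nm; rewrite lee_fin le_truncpow// ltW.
have gw y : limn (g^~ y) = (w y `^ (1 + eps))%:E.
  apply/cvg_lim => //; apply: cvg_near_cst.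
  exists (Num.truncn (w y / l)).+1 => // n /= ln.
  have wl : w y <= 2 ^+ n * l.
    rewrite -ler_pdivrMr//; apply: (le_trans (ltW (truncnS_gt _))).
    apply: (@le_trans _ _ n%:R); first by rewrite ler_nat.
    by rewrite -natrX ler_nat ltnW// ltn_expl.
  rewrite /g /truncpow (min_idPl wl) -[in RHS](mulr_powRB1 (w0 y)); last lra.
  by rewrite (addrC 1 eps) addrK mulrC.
under eq_integral do rewrite -gw.
have mB : measurable (qball rho x r) by exact: (hom_measurable hom).
have mg' n : measurable_fun (qball rho x r) (g n).
  by apply: measurable_funTS; apply/measurable_EFinP; exact: measurable_truncpow.
have g0 n y : qball rho x r y -> (0 <= g n y)%E by move=> _; rewrite lee_fin truncpow_ge0.
rewrite monotone_convergence//.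
apply: lime_le; last by apply: nearW => n; exact: trh.
apply: ereal_nondecreasing_is_cvgn => n m nm; apply: ge0_le_integral => //.
  by move=> y; exact: g0.
by move=> y _; exact: nd.
Qed.

End reverse_holder.

(** * Norms of complex matrices *)

Section complex_modulus.
Local Open Scope sesquilinear_scope.
Local Open Scope complex_scope.
Context {R : realType}.
Implicit Types z : R[i].

Lemma cmodE z : cmod z = Num.sqrt (complex.Re z ^+ 2 + complex.Im z ^+ 2).
Proof. by rewrite /cmod normc_def. Qed.

Lemma cmod_norm z : (cmod z)%:C = `|z|.
Proof. by rewrite cmodE normc_def. Qed.

Lemma cmod_ge0 z : 0 <= cmod z.
Proof. by rewrite cmodE sqrtr_ge0. Qed.

Lemma cmod0 : cmod (0 : R[i]) = 0.
Proof. by rewrite /cmod normr0. Qed.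

Lemma cmodM z1 z2 : cmod (z1 * z2) = cmod z1 * cmod z2.
Proof. by apply: (@complexI R); rewrite rmorphM /= !cmod_norm normrM. Qed.

Lemma le_cmodD z1 z2 : cmod (z1 + z2) <= cmod z1 + cmod z2.
Proof. by rewrite -lecR rmorphD /= !cmod_norm ler_normD. Qed.

Lemma cmod_conj z : cmod (Num.conj z) = cmod z.
Proof. by rewrite /cmod norm_conjC. Qed.

Lemma cmodR (x : R) : cmod x%:C = `|x|.
Proof. by rewrite cmodE /= expr0n addr0 sqrtr_sqr. Qed.

Lemma cmod_eq0 z : cmod z = 0 -> z = 0.
Proof. by move=> z0; apply/normr0_eq0; rewrite -cmod_norm z0. Qed.

Lemma le_cmod_sum (I : Type) (r : seq I) (F : I -> R[i]) :
  cmod (\sum_(i <- r) F i) <= \sum_(i <- r) cmod (F i).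
Proof.
elim/big_rec2: _ => [|i x z _ IH]; first by rewrite cmod0.
by apply: le_trans (le_cmodD _ _) _; rewrite lerD2l.
Qed.

Lemma le_cmod_ReIm z : cmod z <= `|complex.Re z| + `|complex.Im z|.
Proof.
rewrite cmodE -[leRHS]ger0_norm ?addr_ge0// -sqrtr_sqr ler_wsqrtr//.
rewrite sqrrD !real_normK ?num_real// -addrA lerD2l lerDr.
by rewrite mulrn_wge0// mulr_ge0.
Qed.

End complex_modulus.

Section matrix_l1_norm.
Local Open Scope sesquilinear_scope.
Local Open Scope complex_scope.
Context {R : realType}.

(** Being the sum of the moduli of the entries, this norm is manifestly invariant
under the adjoint, and it is comparable with the lengths of the columns. *)
Definition mx_l1 m n (M : 'M[R[i]]_(m, n)) : R := \sum_i \sum_j cmod (M i j).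

Lemma mx_l1_ge0 m n (M : 'M[R[i]]_(m, n)) : 0 <= mx_l1 M.
Proof. by apply: sumr_ge0 => i _; apply: sumr_ge0 => j _; exact: cmod_ge0. Qed.

Lemma mx_l1_adjoint m n (M : 'M[R[i]]_(m, n)) : mx_l1 (M ^t*) = mx_l1 M.
Proof.
rewrite /mx_l1 exchange_big/=; apply: eq_bigr => i _; apply: eq_bigr => j _.
by rewrite !mxE cmod_conj.
Qed.

Lemma mx_l1M m n k (M : 'M[R[i]]_(m, n)) (M' : 'M[R[i]]_(n, k)) :
  mx_l1 (M *m M') <= mx_l1 M * mx_l1 M'.
Proof.
rewrite /mx_l1 mulr_suml; apply: ler_sum => i _.
apply: (@le_trans _ _ (\sum_j \sum_l cmod (M i l) * cmod (M' l j))).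
  apply: ler_sum => j _; rewrite mxE; apply: le_trans (le_cmod_sum _ _) _.
  by under eq_bigr do rewrite cmodM.
rewrite exchange_big/= mulr_suml; apply: ler_sum => l _.
rewrite -mulr_sumr ler_wpM2l ?cmod_ge0// (bigD1 l)//= lerDl.
by apply: sumr_ge0 => j _; apply: sumr_ge0 => j' _; exact: cmod_ge0.
Qed.

Variable N : nat.
Implicit Types (x : 'cV[R[i]]_N) (M : 'M[R[i]]_N).

Lemma cV_norm_ge0 x : 0 <= cV_norm x.
Proof. exact: sqrtr_ge0. Qed.

Lemma cmod_le_cV_norm x i : cmod (x i 0) <= cV_norm x.
Proof.
rewrite /cV_norm -[leLHS]ger0_norm ?cmod_ge0// -sqrtr_sqr ler_wsqrtr//.
by rewrite (bigD1 i)//= lerDl sumr_ge0// => j _; exact: sqr_ge0.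
Qed.

Lemma cV_norm_le_l1 x : cV_norm x <= mx_l1 x.
Proof.
rewrite /cV_norm /mx_l1; under [leRHS]eq_bigr do rewrite big_ord1.
have s0 : 0 <= \sum_i cmod (x i 0) by apply: sumr_ge0 => i _; exact: cmod_ge0.
rewrite -[leRHS]ger0_norm// -sqrtr_sqr ler_wsqrtr//.
rewrite expr2 mulr_suml; apply: ler_sum => i _; rewrite expr2 ler_wpM2l ?cmod_ge0//.
by rewrite (bigD1 i)//= lerDl sumr_ge0// => j _; exact: cmod_ge0.
Qed.

Lemma mx_l1_col_le x : mx_l1 x <= N%:R * cV_norm x.
Proof.
rewrite /mx_l1; under eq_bigr do rewrite big_ord1.
apply: le_trans (ler_sum _ (fun i _ => cmod_le_cV_norm x i)) _.
by rewrite sumr_const card_ord mulr_natl.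
Qed.

Lemma cV_norm_mulmx M x : cV_norm (M *m x) <= N%:R * mx_l1 M * cV_norm x.
Proof.
apply: le_trans (cV_norm_le_l1 _) _; apply: le_trans (mx_l1M _ _) _.
by rewrite [N%:R * _]mulrC -mulrA ler_wpM2l ?mx_l1_ge0// mx_l1_col_le.
Qed.

Lemma cV_norm_eq0 x : cV_norm x = 0 -> x = 0.
Proof.
move=> x0; apply/colP => i; rewrite mxE; apply: cmod_eq0; apply/eqP.
by rewrite eq_le cmod_ge0 andbT -x0 cmod_le_cV_norm.
Qed.

Lemma cV_norm_gt0 x : x != 0 -> 0 < cV_norm x.
Proof.
by move=> x0; rewrite lt_neqAle cV_norm_ge0 andbT eq_sym; apply: contra_neq x0; exact: cV_norm_eq0.
Qed.

Definition unit_cV (j : 'I_N) : 'cV[R[i]]_N := delta_mx j 0.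

Lemma cV_norm_mul_unit_le M j : cV_norm (M *m unit_cV j) <= mx_l1 M.
Proof.
apply: le_trans (cV_norm_le_l1 _) _; rewrite -colE /mx_l1; apply: ler_sum => i _.
rewrite big_ord1 mxE (bigD1 j)//= lerDl.
by apply: sumr_ge0 => k _; exact: cmod_ge0.
Qed.

Lemma mx_l1_le_cols M : mx_l1 M <= N%:R * \sum_j cV_norm (M *m unit_cV j).
Proof.
rewrite mulr_sumr /mx_l1 exchange_big/=; apply: ler_sum => j _.
apply: le_trans _ (mx_l1_col_le _); rewrite /mx_l1; apply: ler_sum => i _.
by rewrite big_ord1 -colE mxE.
Qed.

End matrix_l1_norm.

Lemma rV_norm_coord {R : realType} n (v : 'rV[R]_n) k : `|v 0 k| <= `|v|.
Proof.
rewrite [leRHS]/Num.norm/= mx_normrE.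
by apply: (le_trans _ (le_bigmax _ (fun i => `|v i.1 i.2|) (0, k))).
Qed.

Section norm_equivalence.
Local Open Scope sesquilinear_scope.
Local Open Scope complex_scope.
Context {R : realType} {N : nat} (nrm : 'M[R[i]]_N -> R).
Hypothesis hnrm : is_mx_norm nrm.

Lemma mxnorm_le_l1 : exists2 K : R, 0 < K & forall M, nrm M <= K * mx_l1 M.
Proof.
have n0 : nrm 0 = 0 by have := mxnormZ hnrm 0 0; rewrite scale0r cmod0 mul0r.
pose K := 1 + \sum_i \sum_j nrm (delta_mx i j).
have sum0 i : 0 <= \sum_j nrm (delta_mx i j).
  by apply: sumr_ge0 => j _; exact: (mxnorm_ge0 hnrm).
exists K; first by rewrite ltr_pwDl// sumr_ge0.
have dK i j : nrm (delta_mx i j) <= K.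
  rewrite /K (bigD1 i)//= (bigD1 j)//=.
  have h1 : 0 <= \sum_(k < N | k != j) nrm (delta_mx i k).
    by apply: sumr_ge0 => k _; exact: (mxnorm_ge0 hnrm).
  have h2 : 0 <= \sum_(k < N | k != i) \sum_l nrm (delta_mx k l).
    by apply: sumr_ge0 => k _.
  lra.
move=> M; rewrite {1}[M]matrix_sum_delta.
have nsum (I : Type) (r : seq I) (F : I -> 'M[R[i]]_N) :
    nrm (\sum_(i <- r) F i) <= \sum_(i <- r) nrm (F i).
  elim/big_rec2: _ => [|i x z _ IH]; first by rewrite n0.
  by apply: le_trans (mxnormD hnrm _ _) _; rewrite lerD2l.
apply: le_trans (nsum _ _ _) _; rewrite /mx_l1 mulr_sumr; apply: ler_sum => i _.
apply: le_trans (nsum _ _ _) _; rewrite mulr_sumr; apply: ler_sum => j _.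
by rewrite (mxnormZ hnrm) mulrC ler_wpM2r// cmod_ge0.
Qed.

Let cmx (v : 'rV[R]_(N * N + N * N)) : 'M[R[i]]_N :=
  \matrix_(i, j) (v 0 (lshift _ (mxvec_index i j)) +i* v 0 (rshift _ (mxvec_index i j))).

Let rvec (M : 'M[R[i]]_N) : 'rV[R]_(N * N + N * N) :=
  row_mx (mxvec (map_mx (@complex.Re R) M)) (mxvec (map_mx (@complex.Im R) M)).

Let rvecK M : cmx (rvec M) = M.
Proof.
apply/matrixP => i j; rewrite mxE row_mxEl row_mxEr !mxvecE !mxE.
by case: (M i j).
Qed.

Let cmxK v : rvec (cmx v) = v.
Proof.
apply/rowP => k; rewrite mxE; case: split_ordP => k' ->; case/mxvec_indexP: k' => i j.
  by rewrite mxvecE !mxE.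
by rewrite mxvecE !mxE.
Qed.

Let rvec0 : rvec 0 = 0.
Proof. by rewrite /rvec !map_mx0 !linear0 row_mx0. Qed.

Let cmxB u v : cmx (u - v) = cmx u - cmx v.
Proof. by apply/matrixP => i j; rewrite !mxE. Qed.

Let cmxZ (a : R) v : cmx (a *: v) = a%:C *: cmx v.
Proof.
by apply/matrixP => i j; rewrite !mxE; apply/eqP; rewrite eq_complex /= !mul0r subr0 addr0 !eqxx.
Qed.

Let l1_cmx v : mx_l1 (cmx v) <= N%:R * N%:R * 2 * `|v|.
Proof.
apply: (@le_trans _ _ (\sum_(i < N) \sum_(j < N) (2 * `|v|))).
  apply: ler_sum => i _; apply: ler_sum => j _; rewrite mxE.
  apply: le_trans (le_cmod_ReIm _) _ => /=.
  by rewrite mulr_natl mulr2n lerD// rV_norm_coord.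
by rewrite !sumr_const card_ord -!mulrA !mulr_natl.
Qed.

(** A continuous function without zeros on the unit sphere of the real vector
space of complex matrices, which is compact, has a positive minimum there. *)
Lemma mxnorm_ge_l1 : exists2 k : R, 0 < k & forall M, mx_l1 M <= k * nrm M.
Proof.
have [K K0 KP] := mxnorm_le_l1.
have nN M : nrm (- M) = nrm M.
  by rewrite -scaleN1r (mxnormZ hnrm) /cmod normrN1 mul1r.
have n0 : nrm 0 = 0 by have := mxnormZ hnrm 0 0; rewrite scale0r cmod0 mul0r.
pose f v := nrm (cmx v).
pose L := K * (N%:R * N%:R * 2) + 1.
have L0 : 0 < L by rewrite /L ltr_wpDl// !mulr_ge0// ltW.
(* f is Lipschitz for the supremum norm of the coordinates *)
have flip u v : f u - f v <= L * `|u - v|.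
  apply: (@le_trans _ _ (nrm (cmx u - cmx v))).
    by rewrite lerBlDr; apply: le_trans (mxnormD hnrm _ _); rewrite subrK.
  rewrite -cmxB; apply: le_trans (KP _) _.
  apply: (@le_trans _ _ (K * (N%:R * N%:R * 2 * `|u - v|))).
    by rewrite ler_pM2l.
  by rewrite mulrA ler_wpM2r// /L lerDl.
have fcont : continuous f.
  move=> v A /nbhs_ballP[e /= e0 eA]; apply/nbhs_ballP.
  exists (e / L) => [|u]; first exact: divr_gt0.
  rewrite mx_norm_ball /ball_ /= => uv; apply: eA; rewrite -ball_normE /ball_/=.
  apply: (@le_lt_trans _ _ (L * `|v - u|)); last by rewrite mulrC -ltr_pdivlMr.
  rewrite ler_norml; apply/andP; split; last exact: flip.
  by rewrite lerNl opprB distrC.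
pose S := [set v : 'rV[R]_(N * N + N * N) | `|v| = 1].
have [S0|/set0P Sn0] := eqVneq S set0.
  exists 1 => // M; rewrite mul1r.
  suff -> : M = 0 by rewrite n0 /mx_l1 big1// => i _; rewrite big1// => j _; rewrite mxE cmod0.
  rewrite -(rvecK M); suff -> : rvec M = 0 by rewrite -(scale0r 0) cmxZ scale0r.
  apply/eqP; apply: contrapT => /negP v0.
  suff : S (`|rvec M|^-1 *: rvec M) by rewrite S0.
  by rewrite /S/= normrZ normfV normr_id mulVf// normr_eq0.
have cS : compact S.
  apply: bounded_closed_compact.
    by exists 1; split => // x x1 v /= ->; exact: ltW.
  rewrite (_ : S = (fun v => `|v|) @^-1` [set 1]); last by [].
  by apply: closed_comp; [move=> v _; exact: norm_continuous|exact: closed_eq].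
have [v0 Sv0 vmin] := EVT_min_rV Sn0 cS (continuous_subspaceT fcont).
have fv0 : 0 < f v0.
  rewrite lt_neqAle (mxnorm_ge0 hnrm) andbT; apply/eqP => /esym h.
  have := mxnorm_eq0 hnrm h => cv0.
  have : `|v0| = 1 by move: Sv0; rewrite inE.
  suff -> : v0 = 0 by rewrite normr0 => /esym/eqP; rewrite oner_eq0.
  by rewrite -(cmxK v0) cv0 rvec0.
pose K2 := N%:R * N%:R * 2 + 1 : R.
have K20 : 0 < K2 by rewrite /K2 ltr_wpDl// !mulr_ge0.
exists (K2 / f v0); first exact: divr_gt0.
move=> M; have [->|M0] := eqVneq M 0.
  by rewrite n0 mulr0 /mx_l1 big1// => i _; rewrite big1// => j _; rewrite mxE cmod0.
set v := rvec M.
have v_gt0 : 0 < `|v|.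
  by rewrite normr_gt0; apply: contra_neq M0 => v0_; rewrite -(rvecK M) -/v v0_ -rvec0 rvecK.
have : f v0 <= f (`|v|^-1 *: v).
  by apply: vmin; rewrite inE /S/= normrZ normfV normr_id mulVf// gt_eqF.
rewrite /f cmxZ (mxnormZ hnrm) cmodR ger0_norm ?invr_ge0// rvecK mulrC ler_pdivlMr// => h.
apply: (@le_trans _ _ (K2 * `|v|)).
  rewrite -{1}(rvecK M); apply: le_trans (l1_cmx _) _.
  by rewrite ler_wpM2r// /K2 lerDl.
by rewrite -mulrA ler_pM2l// mulrC ler_pdivlMr// mulrC.
Qed.

End norm_equivalence.

(** * Functional calculus and measurability of matrix powers *)

Section closed_field_matrices.
Local Open Scope sesquilinear_scope.
Local Open Scope complex_scope.
Context {C : numClosedFieldType} {n : nat}.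

Lemma mulmx_conj_diag (U D1 D2 : 'M[C]_n) : U \in unitmx ->
  invmx U *m D1 *m U *m (invmx U *m D2 *m U) = invmx U *m (D1 *m D2) *m U.
Proof. by move=> uU; rewrite !mulmxA mulmxK. Qed.

Lemma adjoint_conj_diag (U : 'M[C]_n) (v : 'rV[C]_n) : U \is unitarymx ->
  (invmx U *m diag_mx v *m U) ^t* = invmx U *m diag_mx (map_mx Num.conj v) *m U.
Proof.
move=> uU; rewrite invmx_unitary//.
by rewrite !trmx_mul !map_mxM/= trmxCK tr_diag_mx map_diag_mx mulmxA.
Qed.

Lemma quadratic_form_conj_diag (U : 'M[C]_n) (v : 'rV[C]_n) k : U \is unitarymx ->
  let x := U ^t* *m delta_mx k 0 : 'cV[C]_n in
  x != 0 /\ (x ^t* *m (invmx U *m diag_mx v *m U) *m x) 0 0 = v 0 k.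
Proof.
move=> uU x; rewrite invmx_unitary//.
have Ux : U *m x = delta_mx k 0.
  by rewrite /x mulmxA; have /unitarymxP -> := uU; rewrite mul1mx.
split.
  apply: contra_eq_neq Ux => ->; rewrite mulmx0 eq_sym; apply/eqP => /colP/(_ k).
  by rewrite !mxE !eqxx => /eqP; rewrite oner_eq0.
have aux (y : 'cV[C]_n) : y ^t* *m (U ^t* *m diag_mx v *m U) *m y =
   (U *m y) ^t* *m diag_mx v *m (U *m y).
  by rewrite trmx_mul map_mxM/= !mulmxA.
rewrite aux Ux mxE (bigD1 k)//= big1 ?addr0; last first.
  by move=> j jk; rewrite [X in _ * X]mxE (negbTE jk) mulr0.
rewrite [X in _ * X]mxE !eqxx mulr1 mxE (bigD1 k)//= big1 ?addr0; last first.
  by move=> j jk; rewrite !mxE (negbTE jk) /= conjC0 mul0r.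
by rewrite !mxE !eqxx /= conjC1 mul1r mulr1n.
Qed.

End closed_field_matrices.

Section functional_calculus.
Local Open Scope sesquilinear_scope.
Local Open Scope complex_scope.
Context {R : realType} {N : nat}.
Implicit Types (A : 'M[R[i]]_N) (f g : R -> R).

Definition spectral_conj A (v : 'rV[R[i]]_N) : 'M[R[i]]_N :=
  invmx (spectralmx A) *m diag_mx v *m spectralmx A.

Definition fcalc f A : 'M[R[i]]_N :=
  spectral_conj A (map_mx (fun z => (f (complex.Re z))%:C) (spectral_diag A)).

Lemma mxpowRE A (s : R) : mxpowR A s = fcalc (fun x => x `^ s) A.
Proof. by []. Qed.

Definition eigen A k : R := complex.Re (spectral_diag A 0 k).

Lemma eq_fcalc f g A : (forall k, f (eigen A k) = g (eigen A k)) -> fcalc f A = fcalc g A.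
Proof.
by move=> fg; congr (spectral_conj A _); apply/rowP => k; rewrite !mxE [f _]fg.
Qed.

Lemma fcalcD f g A : fcalc (fun x => f x + g x) A = fcalc f A + fcalc g A.
Proof.
rewrite /fcalc /spectral_conj -mulmxDl -mulmxDr -linearD/=; congr (spectral_conj A _).
by apply/rowP => k; rewrite !mxE rmorphD.
Qed.

Lemma fcalcM f g A : fcalc (fun x => f x * g x) A = fcalc f A *m fcalc g A.
Proof.
rewrite /fcalc /spectral_conj [RHS]mulmx_conj_diag; last exact: spectral_unit.
rewrite mulmx_diag; congr (spectral_conj A _).
by apply/rowP => k; rewrite !mxE rmorphM.
Qed.

Lemma fcalcD_entry f g A i j :
  fcalc (fun x => f x + g x) A i j = fcalc f A i j + fcalc g A i j.
Proof. by rewrite fcalcD mxE. Qed.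

Lemma fcalcM_entry f g A i j :
  fcalc (fun x => f x * g x) A i j = \sum_k fcalc f A i k * fcalc g A k j.
Proof. by rewrite fcalcM mxE. Qed.

Lemma fcalc_cst (a : R) A : fcalc (fun=> a) A = (a%:C)%:M.
Proof.
rewrite /fcalc /spectral_conj [diag_mx _](_ : _ = (a%:C)%:M).
  by rewrite mul_mx_scalar -scalemxAl mulVmx ?spectral_unit// scalemx1.
by apply/matrixP => i j; rewrite !mxE.
Qed.

Lemma fcalc_id A : A \is hermsymmx -> fcalc id A = A.
Proof.
move=> hA; have /hermitian_normalmx/orthomx_spectralP AE := hA.
rewrite [RHS]AE; congr (spectral_conj A _); apply/rowP => k; rewrite mxE.
by apply: RRe_real; have /mxOverP := hermitian_spectral_diag_real hA; apply.
Qed.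

Lemma fcalc_adjoint f A : (fcalc f A) ^t* = fcalc f A.
Proof.
rewrite /fcalc /spectral_conj (adjoint_conj_diag _ (spectral_unitarymx A)).
congr (spectral_conj A _); apply/rowP => k; rewrite !mxE.
by apply/CrealP; apply/complex_realP; eexists.
Qed.

Lemma eigen_gt0 A k : posdefmx A -> 0 < eigen A k.
Proof.
move=> [hA posA].
have /hermitian_normalmx/orthomx_spectralP AE := hA.
have := quadratic_form_conj_diag (spectral_diag A) k (spectral_unitarymx A).
set x := _ *m _; rewrite -AE => -[x0 xE].
by have := posA x x0; rewrite xE ltcE => /andP[_].
Qed.

Lemma Re_realM (a : R) (z : R[i]) : complex.Re (a%:C * z) = a * complex.Re z.
Proof. by case: z => x y /=; rewrite mul0r subr0. Qed.

Lemma Im_realM (a : R) (z : R[i]) : complex.Im (a%:C * z) = a * complex.Im z.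
Proof. by case: z => x y /=; rewrite mul0r addr0. Qed.

Lemma fcalc_entry f A i j : fcalc f A i j =
  \sum_k (f (eigen A k))%:C * (invmx (spectralmx A) i k * spectralmx A k j).
Proof.
rewrite mxE; apply: eq_bigr => k _; rewrite mul_mx_diag !mxE.
by rewrite mulrA [X in X * _]mulrC.
Qed.

Lemma Re_fcalc_entry f A i j : complex.Re (fcalc f A i j) =
  \sum_k f (eigen A k) * complex.Re (invmx (spectralmx A) i k * spectralmx A k j).
Proof.
rewrite fcalc_entry raddf_sum; apply: eq_bigr => k _.
exact: Re_realM.
Qed.

Lemma Im_fcalc_entry f A i j : complex.Im (fcalc f A i j) =
  \sum_k f (eigen A k) * complex.Im (invmx (spectralmx A) i k * spectralmx A k j).
Proof.
rewrite fcalc_entry raddf_sum; apply: eq_bigr => k _.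
exact: Im_realM.
Qed.

#[local] Opaque fcalc.

(** The spectrum is finite, so that pointwise convergence on it is enough. *)
Lemma cvg_Re_fcalc (f_ : nat -> R -> R) f A i j :
  (forall k, f_ n (eigen A k) @[n --> \oo] --> f (eigen A k)) ->
  complex.Re (fcalc (f_ n) A i j) @[n --> \oo] --> complex.Re (fcalc f A i j).
Proof.
move=> cf.
have E h := Re_fcalc_entry h A i j.
have -> : (fun n => complex.Re (fcalc (f_ n) A i j)) = (fun n => \sum_k f_ n (eigen A k) *
   complex.Re (invmx (spectralmx A) i k * spectralmx A k j)).
  by apply/funext => n; exact: E.
rewrite (E f); apply: cvg_big; first exact: add_continuous.
by move=> k _; apply: cvgM; [exact: cf|exact: cvg_cst].
Qed.

Lemma cvg_Im_fcalc (f_ : nat -> R -> R) f A i j :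
  (forall k, f_ n (eigen A k) @[n --> \oo] --> f (eigen A k)) ->
  complex.Im (fcalc (f_ n) A i j) @[n --> \oo] --> complex.Im (fcalc f A i j).
Proof.
move=> cf.
have E h := Im_fcalc_entry h A i j.
have -> : (fun n => complex.Im (fcalc (f_ n) A i j)) = (fun n => \sum_k f_ n (eigen A k) *
   complex.Im (invmx (spectralmx A) i k * spectralmx A k j)).
  by apply/funext => n; exact: E.
rewrite (E f); apply: cvg_big; first exact: add_continuous.
by move=> k _; apply: cvgM; [exact: cf|exact: cvg_cst].
Qed.

Lemma mxpowRN_r A (s : R) : posdefmx A -> mxpowR A s *m mxpowR A (- s) = 1%:M.
Proof.
move=> pA; rewrite !mxpowRE -fcalcM -(fcalc_cst 1 A); apply: eq_fcalc => k.
rewrite -powRD ?subrr ?powRr0//; apply/implyP => _.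
by rewrite gt_eqF// eigen_gt0.
Qed.

End functional_calculus.

Section log_iteration.
Context {R : realType}.

(** Newton's iteration for the equation [expR y = x] in [y]. *)
Fixpoint lniter (n : nat) (x : R) : R :=
  if n is m.+1 then lniter m x + (x * expR (- lniter m x) - 1) else 0.

(** The error [z = lniter n x - ln x] obeys [z |-> z + exp (- z) - 1].  After
one step it is nonnegative; it is then nonincreasing, and its limit satisfies
[exp (- z) = 1]. *)
Lemma cvg_lniter (x : R) : 0 < x -> lniter n x @[n --> \oo] --> ln x.
Proof.
move=> x0.
pose z n := lniter n.+1 x - ln x.
have step y : ln x <= y + (x * expR (- y) - 1).
  have := expR_ge1Dx (ln x - y); rewrite expRD lnK ?posrE//; lra.
have z0 n : 0 <= z n by rewrite subr_ge0; exact: step.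
have zS n : z n.+1 = z n + (expR (- z n) - 1).
  have lS k : lniter k.+1 x = lniter k x + (x * expR (- lniter k x) - 1) by [].
  rewrite /z [lniter n.+2 x]lS; move: (lniter n.+1 x) => y.
  by rewrite opprB expRD lnK ?posrE//; ring.
have znd : nonincreasing_seq z.
  apply/nonincreasing_seqP => n; rewrite zS gerDl subr_le0.
  by rewrite -expR0 ler_expR oppr_le0.
have cz : cvgn z by apply: nonincreasing_is_cvgn => //; exists 0 => _ [n _ <-].
have zE : expR (- limn z) = 1.
  have c1 : (fun n => z n.+1) @ \oo --> limn z by rewrite (cvg_shiftS z).
  have c2 : (fun n => z n + (expR (- z n) - 1)) @ \oo --> limn z + (expR (- limn z) - 1).
    apply: cvgD => //; apply: cvgB; last exact: cvg_cst.
    by apply: continuous_cvg; [exact: continuous_expR|exact: cvgN].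
  have zSE : (fun n => z n.+1) = (fun n => z n + (expR (- z n) - 1)) by exact/funext.
  rewrite zSE in c1.
  have h : limn z = limn z + (expR (- limn z) - 1) by exact: (cvg_unique _ c1 c2).
  lra.
have lz : limn z = 0.
  by apply/eqP; rewrite -oppr_eq0; apply/eqP; apply: expR_inj; rewrite zE expR0.
rewrite -cvg_shiftS/=.
rewrite (_ : (fun n => _) = (fun n => z n + ln x)); last first.
  by apply/funext => n; rewrite /z subrK.
have : (fun n => z n + ln x) @ \oo --> limn z + ln x by apply: cvgD => //; exact: cvg_cst.
by rewrite lz add0r.
Qed.

End log_iteration.

Section complex_measurable.
Local Open Scope sesquilinear_scope.
Local Open Scope complex_scope.
Context {d : measure_display} {T : measurableType d} {R : realType}.
Variable G : set T.
Implicit Types F : T -> R[i].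

Definition cmeasurable F :=
  measurable_fun G (fun t => complex.Re (F t)) /\
  measurable_fun G (fun t => complex.Im (F t)).

Lemma cmeasurable_cst (z : R[i]) : cmeasurable (fun=> z).
Proof. by split; exact: measurable_cst. Qed.

Lemma cmeasurableD F1 F2 : cmeasurable F1 -> cmeasurable F2 ->
  cmeasurable (fun t => F1 t + F2 t).
Proof.
move=> [r1 i1] [r2 i2]; split.
- rewrite (_ : (fun t => _) = (fun t => complex.Re (F1 t) + complex.Re (F2 t))).
    exact: measurable_funD.
  by apply/funext => t; rewrite raddfD.
- rewrite (_ : (fun t => _) = (fun t => complex.Im (F1 t) + complex.Im (F2 t))).
    exact: measurable_funD.
  by apply/funext => t; rewrite raddfD.
Qed.

Lemma cmeasurableM F1 F2 : cmeasurable F1 -> cmeasurable F2 ->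
  cmeasurable (fun t => F1 t * F2 t).
Proof.
move=> [r1 i1] [r2 i2]; split.
- rewrite (_ : (fun t => _) = (fun t => complex.Re (F1 t) * complex.Re (F2 t) -
      complex.Im (F1 t) * complex.Im (F2 t))).
    by apply: measurable_funB; exact: measurable_funM.
  by apply/funext => t; case: (F1 t) => ? ?; case: (F2 t).
- rewrite (_ : (fun t => _) = (fun t => complex.Re (F1 t) * complex.Im (F2 t) +
      complex.Im (F1 t) * complex.Re (F2 t))).
    by apply: measurable_funD; exact: measurable_funM.
  by apply/funext => t; case: (F1 t) => ? ?; case: (F2 t).
Qed.

Lemma cmeasurable_sum (I : Type) (r : seq I) (F : I -> T -> R[i]) :
  (forall i, cmeasurable (F i)) -> cmeasurable (fun t => \sum_(i <- r) F i t).
Proof.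
move=> mF; elim: r => [|i r IH].
  by under eq_fun do rewrite big_nil; exact: cmeasurable_cst.
by under eq_fun do rewrite big_cons; exact: cmeasurableD.
Qed.

Lemma measurable_cmod F : cmeasurable F ->
  measurable_fun G (fun t => cmod (F t)).
Proof.
move=> [r i]; under eq_fun do rewrite cmodE.
apply: measurableT_comp.
  by apply: continuous_measurable_fun; exact: sqrt_continuous.
by apply: measurable_funD; exact: measurable_funX.
Qed.

End complex_measurable.

Section measurable_functional_calculus.
Local Open Scope sesquilinear_scope.
Local Open Scope complex_scope.
Context {d : measure_display} {T : measurableType d} {R : realType} {N : nat}.
Variables (G : set T) (W : T -> 'M[R[i]]_N).
Hypothesis mW : forall i j, cmeasurable G (fun t => W t i j).
Hypothesis posW : forall t, G t -> posdefmx (W t).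

Definition fcalc_measurable (f : R -> R) :=
  forall i j, cmeasurable G (fun t => fcalc f (W t) i j).

Lemma fcalc_measurable_ext (f g : R -> R) : (forall x, 0 < x -> f x = g x) ->
  fcalc_measurable f -> fcalc_measurable g.
Proof.
move=> fg mf i j; have [r m] := mf i j.
have E t : t \in G -> fcalc f (W t) i j = fcalc g (W t) i j.
  rewrite inE => Gt; rewrite (@eq_fcalc _ _ f g)// => k.
  by apply: fg; apply: eigen_gt0; exact: posW.
split; [apply: eq_measurable_fun r|apply: eq_measurable_fun m] => t Gt.
  exact: (congr1 (@complex.Re R) (E t Gt)).
exact: (congr1 (@complex.Im R) (E t Gt)).
Qed.

Lemma fcalc_measurable_cst (a : R) : fcalc_measurable (fun=> a).
Proof.
by move=> i j; under eq_fun do rewrite fcalc_cst; exact: cmeasurable_cst.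
Qed.

Lemma fcalc_measurable_id : fcalc_measurable id.
Proof.
move=> i j; have [r m] := mW i j.
have E t : t \in G -> W t i j = fcalc id (W t) i j.
  by rewrite inE => Gt; rewrite fcalc_id//; have [] := posW Gt.
split; [apply: eq_measurable_fun r|apply: eq_measurable_fun m] => t Gt.
  exact: (congr1 (@complex.Re R) (E t Gt)).
exact: (congr1 (@complex.Im R) (E t Gt)).
Qed.

Lemma fcalc_measurableD (f g : R -> R) : fcalc_measurable f -> fcalc_measurable g ->
  fcalc_measurable (fun x => f x + g x).
Proof.
move=> mf mg i j; under eq_fun do rewrite fcalcD_entry.
exact: (cmeasurableD (mf i j) (mg i j)).
Qed.

Lemma fcalc_measurableM (f g : R -> R) : fcalc_measurable f -> fcalc_measurable g ->
  fcalc_measurable (fun x => f x * g x).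
Proof.
move=> mf mg i j; under eq_fun do rewrite fcalcM_entry.
by apply: cmeasurable_sum => k; exact: (cmeasurableM (mf i k) (mg k j)).
Qed.

(** Only positive arguments matter, since the eigenvalues are positive. *)
Lemma fcalc_measurable_lim (f_ : nat -> R -> R) (f : R -> R) :
  (forall n, fcalc_measurable (f_ n)) ->
  (forall x, 0 < x -> f_ n x @[n --> \oo] --> f x) -> fcalc_measurable f.
Proof.
move=> mf cf i j; split.
  apply: (measurable_fun_cvg (h := fun n t => complex.Re (fcalc (f_ n) (W t) i j))).
    by move=> n; have [] := mf n i j.
  move=> t Gt; exact: cvg_Re_fcalc (fun k => cf _ (eigen_gt0 k (posW Gt))).
apply: (measurable_fun_cvg (h := fun n t => complex.Im (fcalc (f_ n) (W t) i j))).
  by move=> n; have [] := mf n i j.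
move=> t Gt; exact: cvg_Im_fcalc (fun k => cf _ (eigen_gt0 k (posW Gt))).
Qed.

Lemma fcalc_measurable_expR (f : R -> R) : fcalc_measurable f ->
  fcalc_measurable (fun x => expR (f x)).
Proof.
move=> mf; apply: (@fcalc_measurable_lim (fun n x => series (exp_coeff (f x)) n)); last first.
  by move=> x _; exact: is_cvg_series_exp_coeff.
have mpow n : fcalc_measurable (fun x => f x ^+ n).
  elim: n => [|n IH].
    by under eq_fun do rewrite expr0; exact: fcalc_measurable_cst.
  by under eq_fun do rewrite exprS; exact: fcalc_measurableM.
elim=> [|n IH].
  by rewrite /series/=; under eq_fun do rewrite big_geq//; exact: fcalc_measurable_cst.
rewrite [X in fcalc_measurable X](_ : _ = (fun x => series (exp_coeff (f x)) n +
    f x ^+ n * (n`!%:R)^-1)); last by apply/funext => x; rewrite /series/= big_nat_recr.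
exact: (fcalc_measurableD IH (fcalc_measurableM (mpow n) (fcalc_measurable_cst _))).
Qed.

Lemma fcalc_measurable_ln : fcalc_measurable (@ln R).
Proof.
apply: (@fcalc_measurable_lim (@lniter R)); last exact: cvg_lniter.
elim=> [|n IH]; first exact: fcalc_measurable_cst.
have mE : fcalc_measurable (fun x => expR (- lniter n x)).
  apply: fcalc_measurable_expR; under eq_fun do rewrite -mulN1r.
  exact: (fcalc_measurableM (fcalc_measurable_cst (-1)) IH).
exact: (fcalc_measurableD IH (fcalc_measurableD
  (fcalc_measurableM fcalc_measurable_id mE) (fcalc_measurable_cst (-1)))).
Qed.

Lemma measurable_mxpowR (s : R) i j : cmeasurable G (fun t => mxpowR (W t) s i j).
Proof.
have : fcalc_measurable (fun x => x `^ s).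
  apply: (@fcalc_measurable_ext (fun x => expR (s * ln x))).
    by move=> x x0; rewrite /powR gt_eqF.
  apply: fcalc_measurable_expR.
  exact: (fcalc_measurableM (fcalc_measurable_cst s) fcalc_measurable_ln).
by move=> /(_ i j); under [in X in _ -> X]eq_fun do rewrite mxpowRE.
Qed.

End measurable_functional_calculus.

(** * Integrals and sums of powers *)

Section integral_tools.
Context {d : measure_display} {T : measurableType d} {R : realType}.
Variable mu : {measure set T -> \bar R}.

(** The integral of a nonnegative function is a supremum over the simple
functions below it, so that monotonicity does not require measurability.  This
applies to the inner averages of the A_p condition and to arbitrary matrix
norms. *)
Lemma ge0_le_integral_any (D : set T) (f g : T -> \bar R) :
  (forall x, D x -> (0 <= f x)%E) -> (forall x, D x -> (f x <= g x)%E) ->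
  (\int[mu]_(x in D) f x <= \int[mu]_(x in D) g x)%E.
Proof.
move=> f0 fg; rewrite [leLHS]integral_mkcond [leRHS]integral_mkcond.
have F0 x : (0 <= (f \_ D) x)%E by rewrite patchE; case: ifPn => // /set_mem /f0.
have FG x : ((f \_ D) x <= (g \_ D) x)%E.
  by rewrite !patchE; case: ifPn => // /set_mem /fg.
rewrite !ge0_integralTE//; last by move=> x; exact: le_trans (FG x).
apply: le_ereal_sup => _ [h /= hf <-]; exists h => // x.
exact: le_trans (hf x) (FG x).
Qed.

Lemma markov_inequality (D : set T) (w : T -> R) (s K : R) : measurable D ->
  measurable_fun setT w -> (forall x, 0 <= w x) -> 0 < s ->
  (\int[mu]_(x in D) (w x)%:E <= K%:E * mu D)%E ->
  (mu (D `&` [set x | (s <= w x)%R]) <= (K / s)%:E * mu D)%E.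
Proof.
move=> mD mw w0 s0 wK; have mge := measurable_ge mw s.
have mDge : measurable (D `&` [set x | s <= w x]) by exact: measurableI.
rewrite mulrC EFinM -muleA lee_pdivlMl//.
apply: le_trans wK; apply: le_trans (integral_le_subset mu mw w0 mDge mD (@subIsetl _ _ _)).
by apply: cst_le_integral => //; [exact: ltW|move=> x []].
Qed.

End integral_tools.

Section power_sums.
Context {R : realType} (N : nat).

Lemma powR_sum_le (a : 'I_N -> R) (q : R) : (forall i, 0 <= a i) -> 0 < q ->
  (\sum_i a i) `^ q <= N%:R `^ q * \sum_i a i `^ q.
Proof.
move=> a0 q0; case: N a a0 => [|n] a a0.
  by rewrite !big_ord0 mulr0 powR0// gt_eqF.
pose k := [arg max_(i > ord0) a i]%O.
have kmax i : a i <= a k by rewrite /k; case: arg_maxP => // j _; apply.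
apply: (@le_trans _ _ ((n.+1%:R * a k) `^ q)).
  apply: le_powR => //; [exact: ltW|exact: sumr_ge0|].
  apply: le_trans (ler_sum _ (fun i _ => kmax i)) _.
  by rewrite sumr_const card_ord mulr_natl.
rewrite powRM// ler_wpM2l ?powR_ge0// (bigD1 k)//= lerDl sumr_ge0// => i _.
exact: powR_ge0.
Qed.

End power_sums.

Section vector_norm_measurable.
Context {d : measure_display} {T : measurableType d} {R : realType} {N : nat}.

Lemma measurable_cV_norm_mulmx (V : T -> 'M[R[i]]_N) (y : 'cV[R[i]]_N) (q : R) :
  (forall i j, cmeasurable setT (fun t => V t i j)) ->
  measurable_fun setT (fun t => cV_norm (V t *m y) `^ q).
Proof.
move=> mV; apply: (measurableT_comp (measurable_powR q)).
rewrite /cV_norm; apply: measurableT_comp.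
  by apply: continuous_measurable_fun; exact: sqrt_continuous.
apply: measurable_sum => i; apply: measurable_funX.
apply: measurable_cmod => //; under eq_fun do rewrite mxE.
by apply: cmeasurable_sum => k; apply: cmeasurableM => //; exact: cmeasurable_cst.
Qed.

End vector_norm_measurable.

(** * Matrix weights as families of A_infinity weights *)

Section matrix_weight_reverse_holder.
Local Open Scope sesquilinear_scope.
Local Open Scope complex_scope.
Context {d : measure_display} {T : measurableType d} {R : realType} {N : nat}.
Variable mu : {measure set T -> \bar R}.
Variable rho : T -> T -> R.
Context {c D : R} (hom : is_homogeneous mu rho c D).
Hypothesis N0 : (0 < N)%N.

(** The two-sided comparison is stated for the [q]-th powers and for integrals
instead of averages. *)
Record is_reducing (V : T -> 'M[R[i]]_N) (q k1 k2 : R) (A : set T -> 'M[R[i]]_N) : Prop :=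
  IsReducing {
  red_k1 : 0 < k1 ;
  red_k2 : 0 < k2 ;
  red_inj : forall x (r : R), 0 < r -> forall y : 'cV[R[i]]_N, y != 0 -> A (qball rho x r) *m y != 0 ;
  red_hermitian : forall x (r : R), 0 < r ->
    (A (qball rho x r)) ^t* = A (qball rho x r) ;
  red_lower : forall x (r : R) y, 0 < r ->
    ((k1 * cV_norm (A (qball rho x r) *m y) `^ q)%:E * mu (qball rho x r) <=
     \int[mu]_(t in qball rho x r) (cV_norm (V t *m y) `^ q)%:E)%E ;
  red_upper : forall x (r : R) y, 0 < r ->
    (\int[mu]_(t in qball rho x r) (cV_norm (V t *m y) `^ q)%:E <=
     (k2 * cV_norm (A (qball rho x r) *m y) `^ q)%:E * mu (qball rho x r))%E }.

Variables V V' : T -> 'M[R[i]]_N.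
Variables q q' k1 k2 k1' k2' K : R.
Variables A A' : set T -> 'M[R[i]]_N.
Hypothesis q0 : 0 < q.
Hypothesis q'0 : 0 < q'.
Hypothesis K0 : 0 < K.
Hypothesis mV : forall i j, cmeasurable setT (fun t => V t i j).
Hypothesis mV' : forall i j, cmeasurable setT (fun t => V' t i j).
Hypothesis hV' : forall t, (V' t) ^t* = V' t.
Hypothesis VV' : {ae mu, forall t, V' t *m V t = 1%:M}.
Hypothesis redA : is_reducing V q k1 k2 A.
Hypothesis redA' : is_reducing V' q' k1' k2' A'.
Hypothesis KP : forall x (r : R), 0 < r ->
  mx_l1 (A' (qball rho x r) *m A (qball rho x r)) <= K.

Let NR : R := N%:R.
Let NR0 : 0 < NR. Proof. by rewrite ltr0n. Qed.

Let sigma (s : R) := s `^ q'^-1.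

(** Markov's inequality at proportion [theta] bounds each
[cV_norm (V' t *m (A B *m e_j))] by [sigma (N (k2' K ^ q') / theta)]; the three
factors [N] come from [reducing_norm_le]. *)
Definition weight_eta (theta : R) : R :=
  ((NR * (NR * (NR * sigma (NR * (k2' * K `^ q') / theta)))) `^ q * k2)^-1.

Let k20 := red_k2 redA.
Let k2'0 := red_k2 redA'.

Lemma weight_eta_gt0 theta : 0 < theta -> 0 < weight_eta theta.
Proof.
move=> t0; have s0 : 0 < sigma (NR * (k2' * K `^ q') / theta).
  by rewrite powR_gt0// divr_gt0// !mulr_gt0// powR_gt0.
by rewrite invr_gt0 mulr_gt0// powR_gt0// !mulr_gt0.
Qed.

Let w y t := cV_norm (V t *m y) `^ q.

Let inv_mul_le (a b m z : R) : 0 < a -> 0 < b -> m <= b * (a * z) -> (a * b)^-1 * m <= z.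
Proof.
move=> a0 b0 mz; rewrite mulrC ler_pdivrMr ?mulr_gt0//.
by rewrite (_ : z * (a * b) = b * (a * z))//; ring.
Qed.

(** Insert [V' t *m V t = 1] between [B] and [y], and pass to the adjoint to
turn rows of [B *m V' t] into columns of [V' t *m B]. *)
Lemma reducing_norm_le (B : 'M[R[i]]_N) t y (s : R) : V' t *m V t = 1%:M ->
  B ^t* = B -> 0 <= s ->
  (forall j, cV_norm (V' t *m (B *m unit_cV j)) <= s) ->
  cV_norm (B *m y) <= NR * (NR * (NR * s)) * cV_norm (V t *m y).
Proof.
move=> VV Bh s0 colle.
have -> : B *m y = (B *m V' t) *m (V t *m y).
  by rewrite -mulmxA (mulmxA (V' t)) VV mul1mx.
apply: le_trans (cV_norm_mulmx _ _) _; rewrite ler_wpM2r ?cV_norm_ge0//.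
rewrite ler_wpM2l//.
have -> : mx_l1 (B *m V' t) = mx_l1 (V' t *m B).
  by rewrite -mx_l1_adjoint trmx_mul map_mxM/= hV' Bh.
apply: le_trans (mx_l1_le_cols _) _; rewrite ler_wpM2l//.
apply: (@le_trans _ _ (\sum_(j < N) s)); last by rewrite sumr_const card_ord mulr_natl.
by apply: ler_sum => j _; rewrite -mulmxA.
Qed.

(** The sum [u] of the [|V' A_B e_j| ^ q'] has average at most a constant, because
the columns of [A'_B A_B] are bounded.  Where [u] is at most [s], the lemma
[reducing_norm_le] bounds [w y] from below by a multiple of [|A_B y| ^ q], which
dominates the mean of [w y]. *)
Lemma matrix_weight_Ainfty y : y != 0 -> is_Ainfty mu rho weight_eta (w y).
Proof.
move=> y0.
have mw : measurable_fun setT (w y) by exact: measurable_cV_norm_mulmx.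
have w0 t : 0 <= w y t by exact: powR_ge0.
have up x (r : R) : 0 < r -> mean mu rho (w y) x r <=
    k2 * cV_norm (A (qball rho x r) *m y) `^ q.
  move=> r0; rewrite /mean ler_pdivrMr ?(qball_fine_gt0 hom)//.
  have h := red_upper redA x y r0; rewrite -lee_fin EFinM -(qball_measureE hom)// fineK//.
  rewrite ge0_fin_numE; last by apply: integral_ge0 => t _; rewrite lee_fin.
  by apply: le_lt_trans h _; rewrite (qball_measureE hom)// -EFinM ltry.
split => //.
- move=> x r r0; apply: lt_le_trans (red_lower redA x y r0).
  apply: mule_gt0; last exact: (hom_pos hom).
  rewrite lte_fin mulr_gt0 ?(red_k1 redA)// powR_gt0// cV_norm_gt0//.
  exact: (red_inj redA).
- move=> x r r0; apply: le_lt_trans (red_upper redA x y r0) _.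
  by rewrite (qball_measureE hom)// -EFinM ltry.
move=> theta x r t0 r0; set B := qball rho x r.
have mB : measurable B by exact: (hom_measurable hom).
(* all columns are controlled at once by a single function *)
pose u t := \sum_j cV_norm (V' t *m (A B *m unit_cV j)) `^ q'.
have mfu : measurable_fun setT u.
  by apply: measurable_sum => j; exact: measurable_cV_norm_mulmx.
have u0 t : 0 <= u t by apply: sumr_ge0 => j _; exact: powR_ge0.
have intu : (\int[mu]_(t in B) (u t)%:E <= (NR * (k2' * K `^ q'))%:E * mu B)%E.
  under eq_integral do rewrite -sumEFin.
  rewrite ge0_integral_sum//; first last.
  - by move=> j t _; rewrite lee_fin powR_ge0.
  - move=> j; apply: measurable_funTS; apply/measurable_EFinP.
    exact: measurable_cV_norm_mulmx.
  apply: (@le_trans _ _ (\sum_(j < N) (k2' * K `^ q')%:E * mu B)%E); last first.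
    rewrite -ge0_sume_distrl; last first.
      by move=> j _; rewrite lee_fin mulr_ge0 ?powR_ge0// ltW.
    by rewrite sumEFin sumr_const card_ord mulr_natl.
  apply: lee_sum => j _; apply: le_trans (red_upper redA' x _ r0) _.
  apply: lee_wpmul2r => //; rewrite lee_fin ler_pM2l//; apply: le_powR.
  - exact: ltW.
  - exact: cV_norm_ge0.
  - by rewrite mulmxA; apply: le_trans (cV_norm_mul_unit_le _ _) _; exact: KP.
pose s := NR * (k2' * K `^ q') / theta.
have s0 : 0 < s by rewrite divr_gt0// !mulr_gt0// powR_gt0.
have := markov_inequality mB mfu u0 s0 intu.
have -> : NR * (k2' * K `^ q') / s = theta.
  by rewrite /s invf_div mulrC divfK// gt_eqF// !mulr_gt0// powR_gt0.
apply: le_trans.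
have [Z [mZ Z0 VZ]] := VV'.
have mX : measurable (B `&` [set t | w y t < weight_eta theta * mean mu rho (w y) x r]).
  by apply: measurableI => //; exact: measurable_lt.
have mY : measurable (B `&` [set t | s <= u t]).
  by apply: measurableI => //; exact: measurable_ge.
apply: (@le_trans _ _ (mu ((B `&` [set t | (s <= u t)%R]) `|` Z))).
  apply: le_measure; rewrite ?inE//; first exact: measurableU.
  move=> t [Bt /= wt]; have [Zt|nZt] := pselect (Z t); first by right.
  left; split => //=; rewrite leNgt; apply/negP => us.
  have VVt : V' t *m V t = 1%:M.
    by apply: contrapT => nV; apply: nZt; exact: VZ.
  have colle j : cV_norm (V' t *m (A B *m unit_cV j)) <= sigma s.
    have h : cV_norm (V' t *m (A B *m unit_cV j)) `^ q' <= s.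
      apply: le_trans (ltW us); rewrite /u (bigD1 j)//= lerDl sumr_ge0// => l _.
      exact: powR_ge0.
    have qi0 : 0 <= q'^-1 by rewrite invr_ge0 ltW.
    have := le_powR qi0 (powR_ge0 _ _) h.
    by rewrite -powRrM mulfV ?gt_eqF// powRr1 ?cV_norm_ge0.
  have sg0 : 0 < sigma s by exact: powR_gt0.
  have := reducing_norm_le y VVt (red_hermitian redA x r0) (ltW sg0) colle.
  have S0 : 0 < NR * (NR * (NR * sigma s)) by rewrite !mulr_gt0.
  move: wt; rewrite ltNge => /negP wt h; apply: wt.
  have h1 : cV_norm (A B *m y) `^ q <= (NR * (NR * (NR * sigma s))) `^ q * w y t.
    rewrite -powRM; [|exact: ltW|exact: cV_norm_ge0].
    by apply: le_powR; [exact: ltW|exact: cV_norm_ge0|exact: h].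
  apply: inv_mul_le; [exact: powR_gt0|exact: k20|].
  apply: (le_trans (up x r r0)); rewrite ler_pM2l; [exact: h1|exact: k20].
apply: le_trans (measureU2 _ _ _) _ => //.
by rewrite [X in (_ + X)%E]Z0 adde0.
Qed.

(** Apply the scalar inequality to the weights of the columns of [A'_B]; their
means are bounded through the entries of [A_B A'_B]. *)
Theorem matrix_reverse_holder : exists eps C : R, [/\ 0 < eps, 0 < C &
  forall x (r : R), 0 < r ->
  (\int[mu]_(t in qball rho x r)
     (mx_l1 (V t *m A' (qball rho x r)) `^ (q * (1 + eps)))%:E <=
   C%:E * mu (qball rho x r))%E].
Proof.
have [eps [M [eps0 M0 rh]]] := reverse_holder hom weight_eta_gt0.
pose s := q * (1 + eps); have s0 : 0 < s by rewrite mulr_gt0// addr_gt0.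
pose C1 := M * (k2 * K `^ q) `^ (1 + eps).
have C10 : 0 < C1 by rewrite mulr_gt0// powR_gt0// mulr_gt0// powR_gt0.
pose C := NR `^ s * (NR `^ s * (NR * C1)).
have C0 : 0 < C := mulr_gt0 (powR_gt0 s NR0) (mulr_gt0 (powR_gt0 s NR0) (mulr_gt0 NR0 C10)).
exists eps, C; split => // x r r0; set B := qball rho x r.
have mB : measurable B by exact: (hom_measurable hom).
pose y j := A' B *m unit_cV j : 'cV[R[i]]_N.
have y0 j : y j != 0.
  apply: (red_inj redA') => //; apply/eqP => /colP/(_ j).
  by rewrite !mxE !eqxx => /eqP; rewrite oner_eq0.
have one j : (\int[mu]_(t in B) (w (y j) t `^ (1 + eps))%:E <= C1%:E * mu B)%E.
  have Aw := matrix_weight_Ainfty (y0 j).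
  apply: le_trans (rh _ Aw x r r0) _; apply: lee_wpmul2r => //.
  rewrite lee_fin ler_pM2l//; apply: le_powR.
  - by rewrite addr_ge0// ltW.
  - exact: ltW (mean_gt0 hom Aw x r0).
  - have : mean mu rho (w (y j)) x r <= k2 * cV_norm (A B *m y j) `^ q.
      apply: (qball_cancel hom r0 (x := x)); rewrite -(integral_meanE hom Aw)//.
      exact: (red_upper redA).
    move=> /le_trans; apply; rewrite ler_pM2l//; apply: le_powR.
    + exact: ltW.
    + exact: cV_norm_ge0.
    + rewrite /y mulmxA; apply: le_trans (cV_norm_mul_unit_le _ _) _.
      rewrite -mx_l1_adjoint trmx_mul map_mxM/= (red_hermitian redA)// (red_hermitian redA')//.
      exact: KP.
have mwp j : measurable_fun setT (fun t => w (y j) t `^ (1 + eps)).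
  by apply: (measurableT_comp (measurable_powR (1 + eps))); exact: measurable_cV_norm_mulmx.
apply: (@le_trans _ _ (\int[mu]_(t in B)
    ((NR `^ s * (NR `^ s))%:E * \sum_(j < N) (w (y j) t `^ (1 + eps))%:E))%E).
  apply: ge0_le_integral_any => t _; first by rewrite lee_fin powR_ge0.
  rewrite sumEFin -EFinM lee_fin -mulrA.
  apply: (@le_trans _ _ ((NR * \sum_j cV_norm (V t *m y j)) `^ s)).
    apply: le_powR; [exact: ltW|exact: mx_l1_ge0|].
    apply: le_trans (mx_l1_le_cols _) _; rewrite ler_wpM2l//.
    by apply: ler_sum => j _; rewrite mulmxA.
  rewrite powRM ?(ltW NR0) ?sumr_ge0//; last by move=> j _; exact: cV_norm_ge0.
  rewrite ler_wpM2l ?powR_ge0//.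
  apply: le_trans (powR_sum_le _ s0) _; first by move=> j; exact: cV_norm_ge0.
  rewrite ler_wpM2l ?powR_ge0//; apply: ler_sum => j _.
  by rewrite /w -powRrM.
rewrite ge0_integralZl//; first last.
- by rewrite lee_fin mulr_ge0 ?powR_ge0.
- by move=> t _; apply: sume_ge0 => j _; rewrite lee_fin powR_ge0.
- apply: emeasurable_sum => j; apply: measurable_funTS; exact/measurable_EFinP.
rewrite ge0_integral_sum//; first last.
- by move=> j t _; rewrite lee_fin powR_ge0.
- by move=> j; apply: measurable_funTS; exact/measurable_EFinP.
apply: (@le_trans _ _ ((NR `^ s * NR `^ s)%:E * (\sum_(j < N) C1%:E * mu B))%E).
  by apply: lee_wpmul2l; [rewrite lee_fin mulr_ge0 ?powR_ge0|exact: lee_sum].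
rewrite -ge0_sume_distrl; last by move=> j _; rewrite lee_fin ltW.
rewrite sumEFin sumr_const card_ord -mulr_natl muleA -EFinM; apply: lee_wpmul2r => //.
by rewrite lee_fin /C !mulrA.
Qed.

End matrix_weight_reverse_holder.

(** * The A_p condition and reducing operators *)

Section Ap_condition.
Local Open Scope sesquilinear_scope.
Local Open Scope complex_scope.
Context {d : measure_display} {T : measurableType d} {R : realType} {N : nat}.
Variable mu : {measure set T -> \bar R}.
Variable rho : T -> T -> R.
Context {c D : R} (hom : is_homogeneous mu rho c D).
Hypothesis N0 : (0 < N)%N.
Variables V V' : T -> 'M[R[i]]_N.
Variables q q' k1 k2 k1' k2' : R.
Variables A A' : set T -> 'M[R[i]]_N.
Hypothesis q0 : 0 < q.
Hypothesis q'0 : 0 < q'.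
Hypothesis mV : forall i j, cmeasurable setT (fun t => V t i j).
Hypothesis mV' : forall i j, cmeasurable setT (fun t => V' t i j).
Hypothesis hV : forall t, (V t) ^t* = V t.
Hypothesis hV' : forall t, (V' t) ^t* = V' t.
Hypothesis redA : is_reducing mu rho V q k1 k2 A.
Hypothesis redA' : is_reducing mu rho V' q' k1' k2' A'.

Variables (nrm : 'M[R[i]]_N -> R) (k Z : R).
Hypothesis nrm0 : forall M, 0 <= nrm M.
Hypothesis k0 : 0 < k.
Hypothesis nrmk : forall M, mx_l1 M <= k * nrm M.

Let H B s := ((fine (mu B))^-1%:E *
  \int[mu]_(t in B) (nrm (V s *m V' t) `^ q')%:E)%E.

Hypothesis ApZ : forall x (r : R), 0 < r ->
  (\int[mu]_(s in qball rho x r) (H (qball rho x r) s `^ (q / q')) <=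
   Z%:E * mu (qball rho x r))%E.

Let NR : R := N%:R.
Let NR0 : 0 < NR. Proof. by rewrite ltr0n. Qed.

Let c1 := k `^ (- q') * k1'.
Let c10 : 0 < c1.
Proof. by rewrite mulr_gt0 ?powR_gt0//; exact: (red_k1 redA'). Qed.

(** The inner average bounds the columns of [V' t *m V s], the adjoint of
[V s *m V' t]; the reducing property of [A'] is applied to the columns of [V s]. *)
Lemma inner_average_ge x (r : R) s y : 0 < r ->
  ((c1 * cV_norm (A' (qball rho x r) *m (V s *m unit_cV y)) `^ q')%:E <=
   H (qball rho x r) s)%E.
Proof.
move=> r0; set B := qball rho x r; set v := V s *m unit_cV y.
have mB : measurable B by exact: (hom_measurable hom).
have mw : measurable_fun setT (fun t => cV_norm (V' t *m v) `^ q').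
  exact: measurable_cV_norm_mulmx.
have kq : 0 <= k `^ (- q') by exact: powR_ge0.
have hi : (\int[mu]_(t in B) ((k `^ (- q'))%:E * (cV_norm (V' t *m v) `^ q')%:E) <=
    \int[mu]_(t in B) (nrm (V s *m V' t) `^ q')%:E)%E.
  apply: ge0_le_integral_any => t _; first by rewrite -EFinM lee_fin mulr_ge0 ?powR_ge0.
  rewrite -EFinM lee_fin powRN mulrC ler_pdivrMr ?powR_gt0//.
  rewrite -powRM ?nrm0 ?(ltW k0)//; apply: le_powR; [exact: ltW|exact: cV_norm_ge0|].
  rewrite /v mulmxA; apply: le_trans (cV_norm_mul_unit_le _ _) _.
  by rewrite -mx_l1_adjoint trmx_mul map_mxM/= hV hV' mulrC nrmk.
move: hi; rewrite ge0_integralZl//; first last.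
- by move=> t _; rewrite lee_fin powR_ge0.
- by apply: measurable_funTS; exact/measurable_EFinP.
move=> hi.
have lo := red_lower redA' x v r0.
rewrite /H lee_pdivlMl; last exact: (qball_fine_gt0 hom).
rewrite muleC -(qball_measureE hom x r0).
apply: le_trans hi; rewrite -mulrA EFinM -muleA.
by apply: lee_wpmul2l; rewrite ?lee_fin.
Qed.

(** Raise the previous lower bound to the power [q / q'], integrate it in [s], and
pass from [A'_B V s] to its adjoint [V s A'_B], to which the reducing property
of [A] applies. *)
Lemma Ap_bounds_reducing : exists2 K : R, 0 < K & forall x (r : R), 0 < r ->
  mx_l1 (A' (qball rho x r) *m A (qball rho x r)) <= K.
Proof.
pose c2 := c1 `^ (q / q'); have c20 : 0 < c2 by exact: powR_gt0.
pose K5 := (NR `^ q * NR `^ q) * (NR * (Z / c2)) / k1.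
exists (NR * (NR * K5 `^ q^-1) + 1).
  by rewrite ltr_wpDl// !mulr_ge0// powR_ge0.
move=> x r r0; set B := qball rho x r.
have mB : measurable B by exact: (hom_measurable hom).
pose u j s := cV_norm ((A' B *m V s) *m unit_cV j) `^ q.
have mfu j : measurable_fun setT (u j).
  apply: measurable_cV_norm_mulmx => i l; under eq_fun do rewrite mxE.
  by apply: cmeasurable_sum => n; apply: cmeasurableM => //; exact: cmeasurable_cst.
have u0 j s : 0 <= u j s by exact: powR_ge0.
have one j : (\int[mu]_(s in B) (u j s)%:E <= (Z / c2)%:E * mu B)%E.
  rewrite mulrC EFinM -muleA lee_pdivlMl//.
  apply: le_trans (ApZ x r0).
  rewrite -ge0_integralZl//; first last.
  - by rewrite lee_fin ltW.
  - by move=> s _; rewrite lee_fin.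
  - by apply: measurable_funTS; exact/measurable_EFinP.
  apply: ge0_le_integral_any => s _; first by rewrite -EFinM lee_fin mulr_ge0 ?(ltW c20).
  have h := inner_average_ge x s j r0.
  have qq : 0 <= q / q' by rewrite divr_ge0// ltW.
  have := gt0_ler_poweR qq _ _ h.
  rewrite poweR_EFin powRM ?(ltW c10) ?powR_ge0// -powRrM mulrCA mulfV ?gt_eqF// mulr1.
  rewrite mulmxA -/B -EFinM; apply.
  - by rewrite in_itv/= leey andbT lee_fin mulr_ge0 ?powR_ge0// ltW.
  - rewrite in_itv/= leey andbT; apply: le_trans h.
    by rewrite lee_fin mulr_ge0 ?powR_ge0// ltW.
have two i : cV_norm (A B *m A' B *m unit_cV i) `^ q <= K5.
  rewrite /K5 ler_pdivlMr ?(red_k1 redA)// mulrC.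
  apply: (qball_cancel hom r0 (x := x)).
  rewrite -mulmxA; apply: le_trans (red_lower redA x _ r0) _.
  apply: (@le_trans _ _ (\int[mu]_(s in B)
      ((NR `^ q * NR `^ q)%:E * \sum_(j < N) (u j s)%:E))%E).
    apply: ge0_le_integral_any => s _; first by rewrite lee_fin powR_ge0.
    rewrite sumEFin -EFinM lee_fin -mulrA.
    apply: (@le_trans _ _ ((NR * \sum_j cV_norm ((A' B *m V s) *m unit_cV j)) `^ q)).
      apply: le_powR; [exact: ltW|exact: cV_norm_ge0|].
      rewrite mulmxA; apply: le_trans (cV_norm_mul_unit_le _ _) _.
      rewrite -mx_l1_adjoint trmx_mul map_mxM/= hV (red_hermitian redA')//.
      exact: mx_l1_le_cols.
    rewrite powRM ?(ltW NR0) ?sumr_ge0//; last by move=> j _; exact: cV_norm_ge0.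
    rewrite ler_wpM2l ?powR_ge0//.
    by apply: powR_sum_le => // j; exact: cV_norm_ge0.
  rewrite ge0_integralZl//; first last.
  - by rewrite lee_fin mulr_ge0 ?powR_ge0.
  - by move=> t _; apply: sume_ge0 => j _; rewrite lee_fin.
  - by apply: emeasurable_sum => j; apply: measurable_funTS; exact/measurable_EFinP.
  rewrite ge0_integral_sum//; first last.
  - by move=> j t _; rewrite lee_fin.
  - by move=> j; apply: measurable_funTS; exact/measurable_EFinP.
  rewrite [in leRHS]EFinM -muleA; apply: lee_wpmul2l.
    by rewrite lee_fin mulr_ge0 ?powR_ge0.
  have ZB : (0 <= (Z / c2)%:E * mu B)%E.
    by apply: le_trans (one (Ordinal N0)); apply: integral_ge0 => s _; rewrite lee_fin.
  apply: (@le_trans _ _ (\sum_(j < N) (Z / c2)%:E * mu B)%E); first exact: lee_sum.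
  have Z0 : (0 <= (Z / c2)%:E)%E.
    move: ZB; rewrite (qball_measureE hom)// -EFinM !lee_fin pmulr_lge0//.
    exact: (qball_fine_gt0 hom).
  rewrite -ge0_sume_distrl//.
  by rewrite sumEFin sumr_const card_ord mulr_natl.
apply: (@le_trans _ _ (NR * (NR * K5 `^ q^-1))); last by rewrite lerDl.
rewrite -mx_l1_adjoint trmx_mul map_mxM/= (red_hermitian redA)// (red_hermitian redA')//.
apply: le_trans (mx_l1_le_cols _) _; rewrite ler_wpM2l//.
apply: (@le_trans _ _ (\sum_(j < N) K5 `^ q^-1)); last first.
  by rewrite sumr_const card_ord mulr_natl.
apply: ler_sum => j _.
have qi0 : 0 <= q^-1 by rewrite invr_ge0 ltW.
have := le_powR qi0 (powR_ge0 _ _) (two j).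
by rewrite -powRrM mulfV ?gt_eqF// powRr1 ?cV_norm_ge0.
Qed.

End Ap_condition.

Section complete_measure.
Context {d : measure_display} {T : measurableType d} {R : realType}.
Variable mu : {measure set T -> \bar R}.

(** The values on a null set are irrelevant, every subset of it being measurable. *)
Lemma complete_measurable_fun (G : set T) (f : T -> R) : measure_is_complete mu ->
  measurable G -> mu (~` G) = 0%E -> measurable_fun G f -> measurable_fun setT f.
Proof.
move=> cmu mG G0 mf _ Y mY; rewrite setTI.
rewrite -(setTI (f @^-1` Y)) -(setUv G) setIUl; apply: measurableU; first exact: mf.
by apply: cmu; exists (~` G); split => //; exact: measurableC.
Qed.

Lemma complete_cmeasurable (G : set T) (f : T -> R[i]) : measure_is_complete mu ->
  measurable G -> mu (~` G) = 0%E -> cmeasurable G f -> cmeasurable setT f.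
Proof.
by move=> cmu mG G0 [r i]; split; exact: (complete_measurable_fun cmu mG G0).
Qed.

End complete_measure.

(** * Lebesgue measure on R^d and pseudo-metric balls *)

Section lebesgue_regularity.
Context {R : realType} {d : nat}.
Implicit Types (Q : 'rV[R]_d.+1 * 'rV[R]_d.+1).
Local Notation mu := (lebesgue_mu R d).

Definition open_box Q : set 'rV[R]_d.+1 :=
  [set x | forall i, Q.1 0 i < x 0 i < Q.2 0 i].

Lemma open_box_open Q : open (open_box Q).
Proof.
rewrite openE => x xQ.
pose m := \big[Num.min/1%R]_(i < d.+1) Num.min (x 0 i - Q.1 0 i) (Q.2 0 i - x 0 i).
have m0 : 0 < m.
  apply: lt_bigmin => // i _; rewrite lt_min !subr_gt0; exact: xQ.
have mle i : m <= Num.min (x 0 i - Q.1 0 i) (Q.2 0 i - x 0 i) by exact: bigmin_le_cond.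
apply/nbhs_ballP; exists m => // y xy i.
rewrite mx_norm_ball /ball_/= in xy.
have h := lt_le_trans (le_lt_trans (rV_norm_coord (x - y) i) xy) (mle i).
move: h; rewrite !mxE lt_min !ltr_norml => /andP[/andP[h1 h2] /andP[h3 h4]].
by apply/andP; split; lra.
Qed.

Lemma open_box_sub Q : open_box Q `<=` box Q.
Proof. by move=> x xQ i; have /andP[-> /ltW ->] := xQ i. Qed.

Lemma lebesgue_outer_box Q : (lebesgue_outer (box Q) <= (box_vol Q)%:E)%E.
Proof.
pose Qs (k : nat) : 'rV[R]_d.+1 * 'rV[R]_d.+1 := if k == 0%N then Q else (0, 0).
have v0 : box_vol ((0, 0) : 'rV[R]_d.+1 * 'rV[R]_d.+1) = 0.
  by rewrite /box_vol big_ord_recl /= !mxE subr0 maxxx mul0r.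
have -> : (box_vol Q)%:E = (\sum_(k <oo) (box_vol (Qs k))%:E)%E.
  rewrite (nneseries_split 0 1)//=; last by move=> k _; rewrite lee_fin box_vol_ge0.
  rewrite add0n big_nat1 eseries0 ?adde0// => -[//|k] _ _; exact: congr1 v0.
apply: ereal_inf_lbound; exists Qs => // x xQ; by exists 0%N.
Qed.

Definition enlarge Q (h : R) : 'rV[R]_d.+1 * 'rV[R]_d.+1 := (Q.1, Q.2 + const_mx h).

(** Continuity of the volume in the size of the box. *)
Lemma box_vol_enlarge Q (e : R) : 0 < e ->
  exists2 h, 0 < h & box_vol (enlarge Q h) <= box_vol Q + e.
Proof.
move=> e0.
have cv : box_vol (enlarge Q h) @[h --> (0 : R)] --> box_vol (enlarge Q 0).
  apply: cvg_big; first exact: mul_continuous.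
  move=> i _ /=.
  have E h : (enlarge Q h).2 0 i - (enlarge Q h).1 0 i = Q.2 0 i + h - Q.1 0 i.
    by rewrite !mxE.
  rewrite E; under eq_fun do rewrite E.
  apply: (@continuous_max R R (fun=> 0) (fun h => Q.2 0 i + h - Q.1 0 i) 0).
    exact: cvg_cst.
  by apply: cvgB; [apply: cvgD; [exact: cvg_cst|exact: cvg_id]|exact: cvg_cst].
have E0 : enlarge Q 0 = Q by case: Q {cv} => a b; rewrite /enlarge/= [const_mx 0]raddf0 addr0.
rewrite E0 in cv.
have : box_vol Q < box_vol Q + e by rewrite ltrDl.
move=> /(@cvgr_le _ _ _ _ _ _ cv) /nbhs_ballP[h /= h0 hle].
exists (h / 2); first by rewrite divr_gt0.
by apply: hle; rewrite /ball/= sub0r normrN gtr0_norm ?divr_gt0// ltr_pdivrMr// ltr_pMr// ltr1n.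
Qed.

(** Enlarge the boxes of a nearly optimal cover to open boxes, at a total cost
given by a geometric series. *)
Lemma lebesgue_outer_regular (H : set 'rV[R]_d.+1) (e : R) :
  (lebesgue_outer H < +oo)%E -> 0 < e ->
  exists Q : nat -> 'rV[R]_d.+1 * 'rV[R]_d.+1,
    H `<=` \bigcup_k open_box (Q k) /\
    (lebesgue_outer (\bigcup_k open_box (Q k)) <= lebesgue_outer H + e%:E)%E.
Proof.
move=> Hoo e0; have e20 : 0 < e / 2 by rewrite divr_gt0.
have Hfin : lebesgue_outer H \is a fin_num.
  by rewrite ge0_fin_numE//; exact: (outer_measure_ge0 (@lebesgue_outer R d)).
have [_ [Q HQ <-] Qlt] := lb_ereal_inf_adherent e20 Hfin.
have /choice[h hP] : forall k : nat, exists h : R, 0 < h /\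
    box_vol (enlarge (Q k) h) <= box_vol (Q k) + e / 2 / (2 ^ k.+1)%:R.
  move=> k; have ek : 0 < e / 2 / (2 ^ k.+1)%:R by rewrite divr_gt0// ltr0n expn_gt0.
  by have [h h0 hk] := box_vol_enlarge (Q k) ek; exists h.
exists (fun k => enlarge (Q k) (h k)); split.
  move=> x /HQ[k _ xk]; exists k => // i; have /andP[-> xb] := xk i.
  by rewrite /enlarge/= !mxE; have [h0 _] := hP k; lra.
apply: (@le_trans _ _ (\sum_(k <oo) (box_vol (enlarge (Q k) (h k)))%:E)%E).
  apply: ereal_inf_lbound; exists (fun k => enlarge (Q k) (h k)) => //.
  by apply: subset_bigcup => k _; exact: open_box_sub.
apply: (@le_trans _ _ (\sum_(k <oo) ((box_vol (Q k))%:E + (e / 2 / (2 ^ k.+1)%:R)%:E))%E).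
  apply: lee_nneseries => k; first by move=> _ _; rewrite lee_fin box_vol_ge0.
  by move=> _; rewrite -EFinD lee_fin; have [] := hP k.
apply: le_trans (epsilon_trick _ _ _) _.
- by move=> k; rewrite lee_fin box_vol_ge0.
- exact: ltW.
apply: le_trans (leeD2r _ (ltW Qlt)) _.
by rewrite -addeA -EFinD (_ : e / 2 + e / 2 = e)//; lra.
Qed.

End lebesgue_regularity.

Section pseudo_metric_homogeneous.
Context {R : realType} {d : nat} (rho : 'rV[R]_d.+1 -> 'rV[R]_d.+1 -> R).
Hypothesis hrho : is_pseudo_metric rho.
Local Notation mu := (lebesgue_mu R d).

Lemma rho_ball_small_fin x : exists2 r, 0 < r & (mu (rho_ball rho x r) < +oo)%E.
Proof.
pose Q := (x - const_mx 1, x + const_mx 1) : 'rV[R]_d.+1 * 'rV[R]_d.+1.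
have xQ : open_box Q x by move=> i; rewrite /= !mxE; apply/andP; split; lra.
have [r r0 rQ] := pm_nbhs hrho (@open_box_open R d Q) xQ.
exists r => //; apply: (@le_lt_trans _ _ (box_vol Q)%:E); last exact: ltry.
apply: le_trans (lebesgue_outer_box Q).
apply: (le_outer_measure (@lebesgue_outer R d)).
by apply: subset_trans rQ _; exact: open_box_sub.
Qed.

Lemma rho_ball_pow_doubling : exists2 D : R, 1 <= D &
  (forall x r, 0 < r -> (mu (rho_ball rho x (2 * r)) <= D%:E * mu (rho_ball rho x r))%E) /\
  forall x r n, 0 < r ->
  (mu (rho_ball rho x (2 ^+ n * r)) <= (D ^+ n)%:E * mu (rho_ball rho x r))%E.
Proof.
have [c' c'P] := pm_doubling hrho.
pose D := Num.max 1 c'; have D1 : 1 <= D by rewrite le_max lexx.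
have dbl x r : 0 < r -> (mu (rho_ball rho x (2 * r)) <= D%:E * mu (rho_ball rho x r))%E.
  move=> r0; apply: le_trans (c'P x r r0) _; apply: lee_wpmul2r; first exact: measure_ge0.
  by rewrite lee_fin le_max lexx orbT.
exists D => //; split => // x r n r0.
apply: (@iterate_doubling R (fun s => mu (rho_ball rho x s))) => //.
  exact: le_trans D1.
by move=> s; exact: dbl.
Qed.

Let le_mu (X Y : set 'rV[R]_d.+1) : X `<=` Y -> (mu X <= mu Y)%E.
Proof. exact: (le_outer_measure (@lebesgue_outer R d)). Qed.

Lemma rho_ball_fin x r : 0 < r -> (mu (rho_ball rho x r) < +oo)%E.
Proof.
move=> r0; have [e e0 efin] := rho_ball_small_fin x.
have [D D1 [_ pow]] := rho_ball_pow_doubling.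
have [n rn] := exists_pow2_ge (r / e).
apply: (@le_lt_trans _ _ (mu (rho_ball rho x (2 ^+ n * e)))).
  apply: le_mu => y /= /lt_le_trans; apply.
  by rewrite -ler_pdivrMr.
apply: le_lt_trans (pow x e n e0) _.
rewrite lte_mul_pinfty// lee_fin exprn_ge0//; exact: le_trans D1.
Qed.

(** Every ball lies in some dilate of the null ball. *)
Lemma rho_ball_null x r y s : 0 < r -> 0 < s -> mu (rho_ball rho x r) = 0%E ->
  mu (rho_ball rho y s) = 0%E.
Proof.
move=> r0 s0 xr0; apply/eqP; rewrite eq_le measure_ge0 andbT.
have [D D1 [_ pow]] := rho_ball_pow_doubling.
have [c cP] := pm_triangle hrho.
pose L := `|c| * (rho x y + s).
have [n Ln] := exists_pow2_ge (L / r).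
apply: (@le_trans _ _ (mu (rho_ball rho x (2 ^+ n * r * 2)))).
  apply: le_mu => z /= yz.
  apply: (@le_lt_trans _ _ L).
    apply: le_trans (cP x y z) _; rewrite /L.
    apply: le_trans (ler_wpM2r _ (ler_norm c)) _.
      by rewrite addr_ge0//; exact: (pm_ge0 hrho).
    by rewrite ler_wpM2l// lerD2l ltW.
  rewrite ler_pdivrMr// in Ln; apply: le_lt_trans Ln _.
  by rewrite ltr_pMr ?ltr1n// mulr_gt0// exprn_gt0.
rewrite mulrC mulrA -exprS; apply: le_trans (pow x r n.+1 r0) _.
by rewrite [X in (_ * X)%E]xr0 mule0.
Qed.

Lemma pseudo_metric_homogeneous : (forall x r, 0 < r -> (0 < mu (rho_ball rho x r))%E) ->
  exists c D : R, @is_homogeneous _ (lebesgue_type R d) R mu rho c D.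
Proof.
move=> pos; have [c cP] := pm_triangle hrho.
have [D D1 [dbl _]] := rho_ball_pow_doubling.
exists (Num.max 1 c), D; split => //.
- by rewrite le_max lexx.
- exact: (pm_ge0 hrho).
- exact: (pm_refl hrho).
- exact: (pm_sym hrho).
- move=> x y z; apply: le_trans (cP x y z) _; apply: ler_wpM2r.
    by rewrite addr_ge0//; exact: (pm_ge0 hrho).
  by rewrite le_max lexx orbT.
- by move=> x r r0; exact: (pm_measurable hrho).
- by move=> x r r0; exact: rho_ball_fin.
- move=> H e mH Hoo e0.
  have [Q [HQ Qle]] := lebesgue_outer_regular Hoo e0.
  exists (\bigcup_k open_box (Q k)); split => //.
    move=> x [k _ xk]; have [r r0 rQ] := pm_nbhs hrho (@open_box_open R d (Q k)) xk.
    by exists r => // y /rQ yQ; exists k.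
  move=> V mV VU; apply: le_trans Qle; exact: le_mu.
Qed.

End pseudo_metric_homogeneous.

(** * Matrix weights on R^d *)

Section averages.
Context {R : realType} {d : nat}.
Implicit Types (E : set 'rV[R]_d.+1) (f : 'rV[R]_d.+1 -> \bar R).
Local Notation mu := (lebesgue_mu R d).

Lemma average_le E f (K : R) : (0 < mu E)%E -> (mu E < +oo)%E ->
  (average E f <= K%:E)%E = (\int[mu]_(t in E) f t <= K%:E * mu E)%E.
Proof.
move=> E0 Eoo; have Ef : mu E = (fine (mu E))%:E by rewrite fineK// ge0_fin_numE// ltW.
rewrite /average lee_pdivrMl; first by rewrite muleC -Ef.
by rewrite -lte_fin -Ef.
Qed.

Lemma average_ge E f (K : R) : (0 < mu E)%E -> (mu E < +oo)%E ->
  (K%:E <= average E f)%E = (K%:E * mu E <= \int[mu]_(t in E) f t)%E.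
Proof.
move=> E0 Eoo; have Ef : mu E = (fine (mu E))%:E by rewrite fineK// ge0_fin_numE// ltW.
rewrite /average lee_pdivlMl; first by rewrite muleC -Ef.
by rewrite -lte_fin -Ef.
Qed.

Lemma average_null E f : mu E = 0%E -> average E f = 0%E.
Proof. by move=> E0; rewrite /average E0 invr0 mul0e. Qed.

Lemma average_ge0 E f : (forall t, (0 <= f t)%E) -> (0 <= average E f)%E.
Proof.
move=> f0; rewrite /average mule_ge0//; last exact: integral_ge0.
by rewrite lee_fin invr_ge0 fine_ge0.
Qed.

End averages.

Lemma poweR_invK {R : realType} (x : \bar R) (p : R) : 0 < p -> (0 <= x)%E ->
  ((x `^ p^-1) `^ p)%E = x.
Proof. by move=> p0 x0; rewrite -poweRrM mulVf ?gt_eqF// poweRe1. Qed.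

Lemma le_poweR {R : realType} (x y : \bar R) (p : R) : 0 <= p -> (0 <= x)%E ->
  (x <= y)%E -> (x `^ p <= y `^ p)%E.
Proof.
move=> p0 x0 xy; apply: gt0_ler_poweR => //; rewrite in_itv/= leey andbT//.
exact: le_trans xy.
Qed.

Section transfer.
Context {R : realType} {d N : nat} (rho : 'rV[R]_d.+1 -> 'rV[R]_d.+1 -> R).
Local Notation mu := (lebesgue_mu R d).
Context {c D : R} (hom : @is_homogeneous _ (lebesgue_type R d) R mu rho c D).

Let ball_pos x r : 0 < r -> (0 < mu (rho_ball rho x r))%E.
Proof. exact: (hom_pos hom). Qed.

Let ball_fin x r : 0 < r -> (mu (rho_ball rho x r) < +oo)%E.
Proof. exact: (hom_fin hom). Qed.

Let ball_in x r : 0 < r -> rho_balls rho (rho_ball rho x r).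
Proof. by move=> r0; exists x, r. Qed.

(** Take [q]-th powers, and multiply by the measure of the ball. *)
Lemma reducing_operators_is_reducing (V : 'rV[R]_d.+1 -> 'M[R[i]]_N) (q : R)
    (A : set 'rV[R]_d.+1 -> 'M[R[i]]_N) : 0 < q ->
  reducing_operators (rho_balls rho) V q A ->
  exists k1 k2, @is_reducing _ (lebesgue_type R d) R N mu rho V q k1 k2 A.
Proof.
move=> q0 [posA [c1 [c2 [c10 c20 cA]]]].
exists (c1 `^ q), (c2 `^ q); split.
- exact: powR_gt0.
- exact: powR_gt0.
- move=> x r r0 y y0; have [_ /(_ y y0)] := posA _ (ball_in x r0).
  by apply: contraTneq => Ay; rewrite -mulmxA Ay mulmx0 mxE ltxx.
- move=> x r r0; have [/is_hermitianmxP + _] := posA _ (ball_in x r0).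
  by rewrite expr0 scale1r => <-.
- move=> x r y r0; have /andP[lo _] := cA _ (ball_in x r0) y.
  rewrite -average_ge ?ball_pos ?ball_fin//.
  rewrite -powRM ?cV_norm_ge0 ?(ltW c10)// -poweR_EFin.
  rewrite -(@poweR_invK _ (average _ _) q)//; last first.
    by apply: average_ge0 => t; rewrite lee_fin powR_ge0.
  apply: le_poweR => //; first exact: ltW.
  by rewrite lee_fin mulr_ge0 ?cV_norm_ge0 ?(ltW c10).
- move=> x r y r0; have /andP[_ up] := cA _ (ball_in x r0) y.
  rewrite -average_le ?ball_pos ?ball_fin//.
  rewrite -powRM ?cV_norm_ge0 ?(ltW c20)// -poweR_EFin.
  rewrite -(@poweR_invK _ (average _ _) q)//; last first.
    by apply: average_ge0 => t; rewrite lee_fin powR_ge0.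
  apply: le_poweR => //; first exact: ltW.
  exact: poweR_ge0.
Qed.

Lemma Ap_const_integral_le (nrm : 'M[R[i]]_N -> R) (p p' : R) W : 0 < p ->
  (Ap_const nrm p p' (rho_balls rho) W < +oo)%E ->
  exists Z : R, forall x r, 0 < r ->
  (\int[mu]_(s in rho_ball rho x r) (average (rho_ball rho x r) (fun t =>
     (nrm (mxpowR (W s) p^-1 *m mxpowR (W t) (- p^-1)) `^ p')%:E) `^ (p / p')) <=
   Z%:E * mu (rho_ball rho x r))%E.
Proof.
move=> p0 Apoo.
have [K K0 AK] : exists2 K : R, 0 <= K & (Ap_const nrm p p' (rho_balls rho) W <= K%:E)%E.
  case: (Ap_const _ _ _ _ _) Apoo => [a| |]// _; last by exists 0 => //; exact: leNye.
  by exists `|a| => //; rewrite lee_fin ler_norm.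
exists (K `^ p) => x r r0.
rewrite -average_le ?ball_pos ?ball_fin// -poweR_EFin.
rewrite -[leLHS](@poweR_invK _ _ p)//; last first.
  by apply: average_ge0 => s; exact: poweR_ge0.
apply: le_poweR; [exact: ltW|exact: poweR_ge0|].
apply: le_trans AK; apply: ereal_sup_ubound; exists (rho_ball rho x r) => //.
exact: ball_in.
Qed.

Lemma lebesgue_complete : measure_is_complete (mu : set (lebesgue_type R d) -> \bar R).
Proof. exact: measure_is_complete_caratheodory. Qed.

Lemma weight_power_measurable (W : 'rV[R]_d.+1 -> 'M[R[i]]_N) (s : R) i j :
  is_matrix_weight W ->
  @cmeasurable _ (lebesgue_type R d) R setT (fun t => mxpowR (W t) s i j).
Proof.
move=> [mW [Z [mZ Z0 posZ]]].
apply: (@complete_cmeasurable _ (lebesgue_type R d) R mu (~` Z)).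
- exact: lebesgue_complete.
- exact: measurableC.
- by rewrite setCK.
apply: measurable_mxpowR.
- by move=> k l; have [mr mi] := mW k l; split; exact: measurable_funTS.
- by move=> t nZt; apply: contrapT => npos; apply: nZt; exact: posZ.
Qed.

(** Smaller exponents are controlled by the critical one through
[z ^ q <= 1 + z ^ s]. *)
Lemma average_nrm_le (nrm : 'M[R[i]]_N -> R) (M : 'rV[R]_d.+1 -> 'M[R[i]]_N)
    (K C s q : R) x r : 0 < r -> 0 < q -> q <= s -> 0 <= K ->
  (forall B, 0 <= nrm B) -> (forall B, nrm B <= K * mx_l1 B) ->
  @measurable_fun _ _ (lebesgue_type R d) R setT (fun t => mx_l1 (M t) `^ s) ->
  (\int[mu]_(t in rho_ball rho x r) (mx_l1 (M t) `^ s)%:E <= C%:E * mu (rho_ball rho x r))%E ->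
  (average (rho_ball rho x r) (fun t => (nrm (M t) `^ q)%:E) <= (1 + K `^ s * C)%:E)%E.
Proof.
move=> r0 q0 qs K0 n0 nK mM intM; set B := rho_ball rho x r.
have mB : measurable (B : set (lebesgue_type R d)) by exact: (hom_measurable hom).
rewrite average_le ?ball_pos ?ball_fin//.
apply: (@le_trans _ _ (\int[mu]_(t in B) (1%:E + (K `^ s)%:E * (mx_l1 (M t) `^ s)%:E))%E).
  apply: ge0_le_integral_any => t _; first by rewrite lee_fin powR_ge0.
  rewrite -EFinM -EFinD lee_fin -powRM ?mx_l1_ge0//.
  apply: (@le_trans _ _ ((K * mx_l1 (M t)) `^ q)).
    by apply: le_powR => //; exact: ltW.
  have z0 : 0 <= K * mx_l1 (M t) by rewrite mulr_ge0 ?mx_l1_ge0.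
  have [z1|z1] := leP (K * mx_l1 (M t)) 1.
    apply: (@le_trans _ _ 1); last by rewrite lerDl powR_ge0.
    have <- : 1 `^ q = 1 :> R by rewrite powR1.
    by apply: le_powR => //; exact: ltW.
  apply: (@le_trans _ _ ((K * mx_l1 (M t)) `^ s)); last by rewrite lerDr.
  by apply: ler_powR => //; exact: ltW.
pose f t := (mx_l1 (M t) `^ s)%:E.
have f0 t : (0 <= f t)%E by rewrite lee_fin powR_ge0.
have mf : @measurable_fun _ _ (lebesgue_type R d) _ B f.
  by apply: measurable_funTS; exact/measurable_EFinP.
have Ks0 : (0 <= (K `^ s)%:E)%E by rewrite lee_fin powR_ge0.
have -> : (\int[mu]_(t in B) (1%:E + (K `^ s)%:E * f t) =
    mu B + (K `^ s)%:E * \int[mu]_(t in B) f t)%E.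
  rewrite -(@ge0_integralZl _ (lebesgue_type R d) R mu B mB f mf (K `^ s)%:E (fun t _ => f0 t) Ks0).
  rewrite -[X in (X + _)%E]mul1e -(@integral_cst _ (lebesgue_type R d) R mu B mB).
  apply: ge0_integralD.
  - exact: mB.
  - by move=> t _; rewrite lee_fin.
  - exact: measurable_cst.
  - by move=> t _; rewrite mule_ge0.
  - exact: measurable_funeM.
have Bf : mu B = (fine (mu B))%:E by rewrite fineK// ge0_fin_numE// ?ball_fin.
apply: (@le_trans _ _ (mu B + (K `^ s)%:E * (C%:E * mu B))%E).
  by apply: leeD2l; apply: lee_wpmul2l; [exact: Ks0|exact: intM].
by rewrite Bf -!EFinM -EFinD lee_fin mulrDl mul1r mulrA.
Qed.

End transfer.

Lemma measurable_mx_l1_powR {d : measure_display} {T : measurableType d} {R : realType}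
    {N : nat} (M : T -> 'M[R[i]]_N) (s : R) :
  (forall i j, cmeasurable setT (fun t => M t i j)) ->
  measurable_fun setT (fun t => mx_l1 (M t) `^ s).
Proof.
move=> mM; apply: (measurableT_comp (measurable_powR s)).
by apply: measurable_sum => i; apply: measurable_sum => j; exact: measurable_cmod.
Qed.

Lemma cmeasurable_mulmx_cst {d : measure_display} {T : measurableType d} {R : realType}
    {N : nat} (M : T -> 'M[R[i]]_N) (B : 'M[R[i]]_N) i j :
  (forall i j, cmeasurable setT (fun t => M t i j)) ->
  cmeasurable setT (fun t => (M t *m B) i j).
Proof.
move=> mM; under eq_fun do rewrite mxE.
by apply: cmeasurable_sum => k; apply: cmeasurableM => //; exact: cmeasurable_cst.
Qed.

Lemma cmeasurable_cst_mulmx {d : measure_display} {T : measurableType d} {R : realType}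
    {N : nat} (M : T -> 'M[R[i]]_N) (B : 'M[R[i]]_N) i j :
  (forall i j, cmeasurable setT (fun t => M t i j)) ->
  cmeasurable setT (fun t => (B *m M t) i j).
Proof.
move=> mM; under eq_fun do rewrite mxE.
by apply: cmeasurable_sum => k; apply: cmeasurableM => //; exact: cmeasurable_cst.
Qed.

Theorem proposition3p3 (R : realType) (d N : nat) (hN : (0 < N)%N)
  (nrm : 'M[R[i]]_N -> R) (hnrm : is_mx_norm nrm)
  (rho : 'rV[R]_d.+1 -> 'rV[R]_d.+1 -> R) (hrho : is_pseudo_metric rho)
  (p p' : R) (hp : 1 < p) (hpp' : p^-1 + p'^-1 = 1)
  (W : 'rV[R]_d.+1 -> 'M[R[i]]_N) (hW : in_Ap nrm p p' (rho_balls rho) W)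
  (A Asharp : set 'rV[R]_d.+1 -> 'M[R[i]]_N)
  (hA : reducing_operators (rho_balls rho) (fun t => mxpowR (W t) p^-1) p A)
  (hAsharp : reducing_operators (rho_balls rho)
               (fun t => mxpowR (W t) (- p^-1)) p' Asharp) :
  exists (delta : R) (C : R -> R), 0 < delta /\
    forall B, rho_balls rho B ->
      (forall q : R, 0 < q < p + delta ->
         (average B (fun t => (nrm (mxpowR (W t) p^-1 *m Asharp B) `^ q)%:E)
            <= (C q)%:E)%E) /\
      (forall q : R, 0 < q < p' + delta ->
         (average B (fun x => (nrm (A B *m mxpowR (W x) (- p^-1)) `^ q)%:E)
            <= (C q)%:E)%E).
Proof.
have p0 : 0 < p by exact: lt_trans hp.
have p'0 : 0 < p'.
  rewrite -invr_gt0 (_ : p'^-1 = 1 - p^-1); last by rewrite -hpp' addrC addKr.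
  by rewrite subr_gt0 invf_lt1.
(* either some ball, hence every ball, is null, or all balls are positive *)
have [[x0 [r0 [r00 null]]]|pos] := pselect (exists x r, 0 < r /\
    lebesgue_mu R d (rho_ball rho x r) = 0%E).
  exists 1, (fun=> 0); split => // B [x [r [rp ->]]].
  have Bnull : lebesgue_mu R d (rho_ball rho x r) = 0%E.
    exact: (@rho_ball_null R d rho hrho x0 r0 x r r00 rp null).
  by split => q _; rewrite average_null.
have [c [D hom]] : exists c D : R,
    @is_homogeneous _ (lebesgue_type R d) R (lebesgue_mu R d) rho c D.
  apply: (pseudo_metric_homogeneous hrho) => x r rp.
  rewrite lt_neqAle measure_ge0 andbT; apply/eqP => /esym null.
  by apply: pos; exists x, r.
have [wW Apoo] := hW.
have [k1 [k2 redA]] := reducing_operators_is_reducing hom p0 hA.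
have [k1' [k2' redA']] := reducing_operators_is_reducing hom p'0 hAsharp.
have [Z ApZ] := Ap_const_integral_le hom p0 Apoo.
have [Ku Ku0 nrmU] := mxnorm_le_l1 hnrm.
have [Kl Kl0 nrmL] := mxnorm_ge_l1 hnrm.
have nrm0 := mxnorm_ge0 hnrm.
set V : lebesgue_type R d -> 'M[R[i]]_N := fun t => mxpowR (W t) p^-1.
set V' : lebesgue_type R d -> 'M[R[i]]_N := fun t => mxpowR (W t) (- p^-1).
have mV i j : cmeasurable setT (fun t => V t i j) by exact: weight_power_measurable.
have mV' i j : cmeasurable setT (fun t => V' t i j) by exact: weight_power_measurable.
have hV t : ((V t) ^t*)%sesqui = V t by rewrite /V mxpowRE; exact: fcalc_adjoint.
have hV' t : ((V' t) ^t*)%sesqui = V' t by rewrite /V' mxpowRE; exact: fcalc_adjoint.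
have [N0 [mN0 N00 posW]] := weight_posdef wW.
have VV' : {ae lebesgue_mu R d, forall t, V t *m V' t = 1%:M}.
  exists N0; split => // t /= nVV; apply: posW => /= posWt; apply: nVV.
  exact: mxpowRN_r.
have V'V : {ae lebesgue_mu R d, forall t, V' t *m V t = 1%:M}.
  exists N0; split => // t /= nVV; apply: posW => /= posWt; apply: nVV.
  by have := @mxpowRN_r R N (W t) (- p^-1) posWt; rewrite opprK.
have [K K0 KP] := Ap_bounds_reducing hom hN p0 p'0 mV mV' hV hV' redA redA' nrm0 Kl0 nrmL ApZ.
have KP' x r : 0 < r -> mx_l1 (A (rho_ball rho x r) *m Asharp (rho_ball rho x r)) <= K.
  move=> rp; rewrite -mx_l1_adjoint trmx_mul map_mxM/=.
  by rewrite (red_hermitian redA)// (red_hermitian redA')//; exact: KP.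
have [e1 [C1 [e10 C10 main1]]] :=
  matrix_reverse_holder hom hN p0 p'0 K0 mV mV' hV' V'V redA redA' KP.
have [e2 [C2 [e20 C20 main2]]] :=
  matrix_reverse_holder hom hN p'0 p0 K0 mV' mV hV VV' redA' redA KP'.
pose s1 := p * (1 + e1); pose s2 := p' * (1 + e2).
pose delta := Num.min (p * e1) (p' * e2).
have d0 : 0 < delta by rewrite lt_min !mulr_gt0.
have d1 : p + delta <= s1 by rewrite /s1 mulrDr mulr1 lerD2l ge_min lexx.
have d2 : p' + delta <= s2 by rewrite /s2 mulrDr mulr1 lerD2l ge_min lexx orbT.
exists delta, (fun=> Num.max (1 + Ku `^ s1 * C1) (1 + Ku `^ s2 * C2)).
split=> // B [x [r [rp ->]]]; split => q /andP[q0 qlt].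
- apply: (@le_trans _ _ (1 + Ku `^ s1 * C1)%:E); last by rewrite lee_fin le_max lexx.
  have mVA := measurable_mx_l1_powR s1
    (fun i j => cmeasurable_mulmx_cst (Asharp (rho_ball rho x r)) i j mV).
  exact: (average_nrm_le hom rp q0 (le_trans (ltW qlt) d1) (ltW Ku0) nrm0 nrmU mVA
    (main1 x r rp)).
- apply: (@le_trans _ _ (1 + Ku `^ s2 * C2)%:E); last by rewrite lee_fin le_max lexx orbT.
  have mAV' := measurable_mx_l1_powR s2
    (fun i j => cmeasurable_cst_mulmx (A (rho_ball rho x r)) i j mV').
  have l1E t : mx_l1 (A (rho_ball rho x r) *m V' t) = mx_l1 (V' t *m A (rho_ball rho x r)).
    by rewrite -mx_l1_adjoint trmx_mul map_mxM/= hV' (red_hermitian redA).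
  have := main2 x r rp; under eq_integral do rewrite -l1E.
  exact: (average_nrm_le hom rp q0 (le_trans (ltW qlt) d2) (ltW Ku0) nrm0 nrmU mAV').
Qed.
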